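(* Let $W=(W_t)_{t\ge 0}$ be an $n$-dimensional standard Brownian motion. For a function $f=(f_1,\dots,f_m):\mathbb{R}^n\to\mathbb{R}^m$ the following assertions are equivalent: (i) $f$ is a measurable function satisfying the Cauchy functional equation $f(x+y)=f(x)+f(y)$ for almost all $(x,y)$ in the sense of Lebesgue measure on $\mathbb{R}^{2n}$. (ii) $f$ is a measurable function such that the transformed process $(f(W_t))_{t\ge0}$ is a martingale satisfying the following condition: for each $j=1,\dots,m$ there is a constant $C_j\in\mathbb{R}$ such that the process $\langle f_j(W)\rangle_t-C_jt$, $t\ge 0$, is non-increasing. (iii) There is a constant $m\times n$ real matrix $A$ such that $f(x)=Ax$ for almost all $x$ in the sense of Lebesgue measure on $\mathbb{R}^n$.
   Context: $W$ is defined on a probability space $(\Omega,\mathcal{F},P)$ and starts at $0$; martingales are taken with respect to the filtration $F^W=(\mathcal{F}^W_t)_{t\ge0}$ generated by $W$ (completed by $P$-null sets). An $\mathbb{R}^m$-valued process is a martingale if each component is a martingale; no path regularity of the martingale is assumed. Every $F^W$-martingale $M$ has a continuous modification $\tilde M$, which is a locally square integrable martingale, and the square characteristic of $M$ is defined by $\langle M\rangle:=\langle\tilde M\rangle$, the predictable quadratic variation of $\tilde M$. Monotonicity of a process in $t$ is understood for almost all paths.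
   Formalization: The equivalences involving (ii) are proved under the added assumption f(0)=0, without which they fail (f(x)=x+b satisfies (ii) but not (i) or (iii)); (i)⇔(iii) holds for all f. ''Measurable'' means Lebesgue measurable and P is taken complete. *)

(* Defs.v *)
From HB Require Import structures.
From mathcomp Require Import all_boot all_order all_algebra.
From mathcomp Require Import all_classical all_reals all_analysis.
From mathcomp Require Import measurable_realfun.

Set Implicit Arguments.
Unset Strict Implicit.
Unset Printing Implicit Defensive.
Import Order.TTheory GRing.Theory Num.Theory.
Import numFieldNormedType.Exports.

Local Open Scope classical_set_scope.
Local Open Scope ring_scope.

(* R^n is the type 'cV[R]_n of column vectors. *)

Definition measure_cV_display : measure_display.
Proof. exact: default_measure_display. Qed.

Section measurable_cV.
Variables (R : realType) (n : nat).

Definition cV_coord (i : 'I_n) (x : 'cV[R]_n) : R := x i ord0.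

Let cV_set0 : g_sigma_preimage cV_coord set0.
Proof. exact: sigma_algebra0. Qed.

Let cV_setC A : g_sigma_preimage cV_coord A -> g_sigma_preimage cV_coord (~` A).
Proof. exact: sigma_algebraC. Qed.

Let cV_bigcup (F : (set 'cV[R]_n)^nat) :
  (forall i, g_sigma_preimage cV_coord (F i)) ->
  g_sigma_preimage cV_coord (\bigcup_i (F i)).
Proof. exact: sigma_algebra_bigcup. Qed.

HB.instance Definition _ := @isMeasurable.Build measure_cV_display
  'cV[R]_n (g_sigma_preimage cV_coord) cV_set0 cV_setC cV_bigcup.

End measurable_cV.

Lemma measurable_cV_coord (R : realType) (n : nat) (i : 'I_n) :
  measurable_fun [set: 'cV[R]_n] (cV_coord i).
Proof.
move=> _ Y mY; rewrite setTI; apply: sub_sigma_algebra => /=.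
rewrite -bigcup_seq/=; exists i => /=; first by rewrite mem_index_enum.
by exists Y => //; rewrite setTI.
Qed.

Lemma measurable_fun_cV (R : realType) (n : nat) d (T : measurableType d)
    (f : T -> 'cV[R]_n) :
  (forall i, measurable_fun [set: T] (cV_coord i \o f)) ->
  measurable_fun [set: T] f.
Proof.
move=> mf _ A mA; rewrite setTI.
pose S : set (set 'cV[R]_n) := [set B | d.-measurable (f @^-1` B)].
suff : (measurable : set (set 'cV[R]_n)) `<=` S by apply.
apply: smallest_sub.
  split; rewrite /S/=.
  - by rewrite preimage_set0.
  - by move=> B mB; rewrite setTD preimage_setC; exact: measurableC.
  - by move=> F mF; rewrite preimage_bigcup; exact: bigcup_measurable.
rewrite -bigcup_seq => B [i _ [C mC <-]]; rewrite /S/= setTI.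
by have := mf i measurableT C mC; rewrite setTI.
Qed.

Lemma sigma_finite_product d1 d2 (T1 : measurableType d1)
    (T2 : measurableType d2) (R : realType)
    (m1 : {sigma_finite_measure set T1 -> \bar R})
    (m2 : {sigma_finite_measure set T2 -> \bar R}) :
  sigma_finite setT (m1 \x m2)%E.
Proof.
have /sigma_finiteP[F [TF ndF Foo]] := sigma_finiteT m1.
have /sigma_finiteP[G [TG ndG Goo]] := sigma_finiteT m2.
exists (fun n => F n `*` G n).
  rewrite -setXTT TF TG predeqE => -[x y]; split.
    move=> [/= [n _ Fnx] [k _ Gky]]; exists (maxn n k) => //; split.
    - by move: x Fnx; exact/subsetPset/ndF/leq_maxl.
    - by move: y Gky; exact/subsetPset/ndG/leq_maxr.
  by move=> [n _ []/= ? ?]; split; exists n.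
move=> k; have [? ?] := Foo k; have [? ?] := Goo k.
split; first exact: measurableX.
by rewrite product_measure1E// lte_mul_pinfty// ge0_fin_numE.
Qed.

Section lebesgue_cV.
Variable R : realType.

Definition cV_cons (n : nat) (x : R * 'cV[R]_n) : 'cV[R]_n.+1 :=
  col_mx x.1%:M x.2.

Definition cV_split (n : nat) (v : 'cV[R]_n.+1) : R * 'cV[R]_n :=
  (v ord0 ord0, dsubmx (v : 'cV[R]_(1 + n))).

Lemma cV_consK (n : nat) : cancel (@cV_cons n) (@cV_split n).
Proof.
move=> [a v]; rewrite /cV_split /cV_cons/=; congr pair.
  by rewrite mxE; case: splitP => // j _; rewrite (ord1 j) mxE eqxx.
exact: col_mxKd.
Qed.

Lemma measurable_cV_cons (n : nat) :
  measurable_fun [set: R * 'cV[R]_n] (@cV_cons n).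
Proof.
apply: measurable_fun_cV => i; rewrite /cV_cons.
rewrite -(splitK (i : 'I_(1 + n))).
case: (fintype.split (i : 'I_(1 + n))) => j /=.
  rewrite (_ : _ \o _ = fst) //.
  apply/funext => x; rewrite /comp /cV_coord.
  by rewrite (col_mxEu x.1%:M x.2) (ord1 j) mxE eqxx.
rewrite (_ : _ \o _ = cV_coord j \o snd).
  by apply: measurableT_comp => //; exact: measurable_cV_coord.
by apply/funext => x; rewrite /comp /cV_coord (col_mxEd x.1%:M x.2).
Qed.

Lemma measurable_cV_split (n : nat) :
  measurable_fun [set: 'cV[R]_n.+1] (@cV_split n).
Proof.
apply: measurable_fun_pair; first exact: (@measurable_cV_coord R n.+1 ord0).
apply: measurable_fun_cV => i.
rewrite (_ : _ \o _ = cV_coord (rshift 1 i)).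
  exact: measurable_cV_coord.
by apply/funext => v; rewrite /= /cV_coord mxE.
Qed.

Section step.
Variables (n : nat) (mu : {sigma_finite_measure set 'cV[R]_n -> \bar R}).

Definition lebesgue_cV_step : set 'cV[R]_n.+1 -> \bar R :=
  pushforward (lebesgue_measure \x mu)%E (@cV_cons n).

Let step0 : lebesgue_cV_step set0 = 0%E.
Proof. by rewrite /lebesgue_cV_step /pushforward preimage_set0 measure0. Qed.

Let step_ge0 A : (0 <= lebesgue_cV_step A)%E.
Proof. by rewrite /lebesgue_cV_step /pushforward measure_ge0. Qed.

Let step_preimage A : measurable A -> measurable (@cV_cons n @^-1` A).
Proof. by move=> mA; rewrite -[X in measurable X]setTI; exact: measurable_cV_cons. Qed.

Let step_sigma_additive : semi_sigma_additive lebesgue_cV_step.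
Proof.
move=> F mF tF mUF; rewrite /lebesgue_cV_step /pushforward preimage_bigcup.
apply: measure_semi_sigma_additive.
- by move=> k; exact: step_preimage.
- apply/trivIsetP => /= i j _ _ ij; rewrite -preimage_setI.
  by move/trivIsetP : tF => /(_ _ _ _ _ ij) ->//; rewrite preimage_set0.
- by rewrite -preimage_bigcup; exact: step_preimage.
Qed.

HB.instance Definition _ := isMeasure.Build _ _ _ lebesgue_cV_step
  step0 step_ge0 step_sigma_additive.

Let step_sigma_finite : sigma_finite setT lebesgue_cV_step.
Proof.
have [F FT mF] := sigma_finite_product (@lebesgue_measure R) mu.
exists (fun k => @cV_split n @^-1` F k).
  by rewrite -preimage_bigcup -FT preimage_setT.
move=> k; have [mFk Fk] := mF k; split.
  by rewrite -[X in measurable X]setTI; exact: measurable_cV_split.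
rewrite /lebesgue_cV_step /pushforward.
rewrite (_ : _ @^-1` _ = F k)//; apply/funext => x /=.
by rewrite /preimage/= cV_consK.
Qed.

HB.instance Definition _ := Measure_isSigmaFinite.Build _ _ _ lebesgue_cV_step
  step_sigma_finite.

End step.

(* Lebesgue measure on the Borel sets of R^n, as an iterated product measure;
   the values on boxes are given by lebesgue_cV_box below *)
Fixpoint lebesgue_cV (n : nat) : {sigma_finite_measure set 'cV[R]_n -> \bar R} :=
  match n with
  | 0 => \d_(0 : 'cV[R]_0)
  | n'.+1 => lebesgue_cV_step (lebesgue_cV n')
  end.

End lebesgue_cV.

Lemma lebesgue_cV_box (R : realType) (n : nat) (B : 'I_n -> set R) :
  (forall i, measurable (B i)) ->
  lebesgue_cV R n [set x | forall i, B i (x i ord0)] =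
  (\prod_(i < n) lebesgue_measure (B i))%E.
Proof.
elim: n B => [|n IHn] B mB.
  rewrite big_ord0 /= diracE mem_set//= => -[]//.
rewrite big_ord_recl -IHn; last by move=> i; exact: mB.
have mE : measurable
    [set v : 'cV[R]_n | forall i, B (lift ord0 i) (v i ord0)].
  rewrite (_ : [set _ | _] =
      \bigcap_(i in [set: 'I_n]) (cV_coord i @^-1` B (lift ord0 i))).
    apply: fin_bigcap_measurable; first exact: (@finite_finset (ordinal n)).
    by move=> i _; rewrite -[X in measurable X]setTI; exact: measurable_cV_coord.
  by apply/seteqP; split => x /= h i; [move=> _; exact: h|exact: h].
rewrite -product_measure1E//; last exact: mB.
rewrite /= /lebesgue_cV_step /pushforward; congr (_ \x _)%E.
apply/seteqP; split => -[a v] /= => [h|[ha hv] i].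
  split.
    have := h ord0.
    rewrite (_ : cV_cons _ _ _ = a)//.
    exact: (congr1 fst (cV_consK (a, v))).
  move=> i; have := h (lift ord0 i).
  rewrite (_ : lift ord0 i = rshift 1 i); last exact: val_inj.
  by rewrite /cV_cons (col_mxEd a%:M v).
have [j ->|->] := unliftP ord0 i.
  rewrite (_ : cV_cons _ _ _ = v j ord0); first exact: hv.
  rewrite (_ : lift ord0 j = rshift 1 j); last exact: val_inj.
  by rewrite /cV_cons (col_mxEd a%:M v).
by rewrite (_ : cV_cons _ _ _ = a)//; exact: (congr1 fst (cV_consK (a, v))).
Qed.

(* Measurability with respect to the Lebesgue (i.e. completed) sigma-algebra
   of the domain: Borel measurability would not be invariant under
   modification of f on a null set. *)
Definition lebesgue_measurable_fun (R : realType) (n m : nat)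
    (f : 'cV[R]_n -> 'cV[R]_m) : Prop :=
  forall B : set 'cV[R]_m, measurable B ->
    completed_algebra_gen (lebesgue_cV R n) (f @^-1` B).

(* Time is [0, +oo[: processes are indexed by R, and
   their values at negative times are irrelevant. A sub-sigma-algebra of Omega
   is a set of subsets of Omega. *)
Section processes.
Context {d : measure_display} {Omega : measurableType d} {R : realType}.
Variable P : probability Omega R.

Definition measurable_wrt (G : set (set Omega)) (X : Omega -> R) : Prop :=
  forall B : set R, measurable B -> G (X @^-1` B).

Definition is_cond_expectation (G : set (set Omega)) (X Y : Omega -> R) : Prop :=
  [/\ measurable_wrt G Y,
      P.-integrable setT (EFin \o Y) &
      forall A, G A ->
        (\int[P]_(w in A) (Y w)%:E = \int[P]_(w in A) (X w)%:E)%E].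

Definition martingale (F : R -> set (set Omega)) (M : R -> Omega -> R) : Prop :=
  [/\ forall t, 0 <= t -> measurable_wrt (F t) (M t),
      forall t, 0 <= t -> P.-integrable setT (EFin \o M t) &
      forall s t, 0 <= s -> s <= t -> is_cond_expectation (F s) (M t) (M s)].

Definition vector_martingale (m : nat) (F : R -> set (set Omega))
    (M : R -> Omega -> 'cV[R]_m) : Prop :=
  forall j : 'I_m, martingale F (fun t w => M t w j ord0).

Definition square_integrable_martingale (F : R -> set (set Omega))
    (M : R -> Omega -> R) : Prop :=
  martingale F M /\
  exists C : R, forall t, 0 <= t -> (\int[P]_w ((M t w) ^+ 2)%:E <= C%:E)%E.

Definition stopping_time (F : R -> set (set Omega)) (tau : Omega -> \bar R) :
    Prop :=
  (forall w, (0 <= tau w)%E) /\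
  (forall t, 0 <= t -> F t [set w | (tau w <= t%:E)%E]).

Definition stopped (X : R -> Omega -> R) (tau : Omega -> \bar R) :
    R -> Omega -> R :=
  fun t w => X (fine (Order.min t%:E (tau w))) w.

Definition localizing_sequence (F : R -> set (set Omega))
    (tau : nat -> Omega -> \bar R) : Prop :=
  (forall k, stopping_time F (tau k)) /\
  \forall w \ae P, (forall k, (tau k w <= tau k.+1 w)%E) /\
                   tau k w @[k --> \oo] --> +oo%E.

Definition local_martingale (F : R -> set (set Omega)) (X : R -> Omega -> R) :
    Prop :=
  exists2 tau, localizing_sequence F tau &
    forall k, martingale F (stopped X (tau k)).

Definition locally_square_integrable_martingale (F : R -> set (set Omega))
    (M : R -> Omega -> R) : Prop :=
  exists2 tau, localizing_sequence F tau &
    forall k, square_integrable_martingale F (stopped M (tau k)).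

Definition predictable_sets (F : R -> set (set Omega)) : set (set (R * Omega)) :=
  <<s [set p | 0 <= p.1],
      [set [set 0] `*` A | A in F 0] `|`
      [set D | exists s t A, [/\ 0 <= s, s < t, F s A &
                               D = `]s, t]%classic `*` A]] >>.

Definition predictable (F : R -> set (set Omega)) (X : R -> Omega -> R) : Prop :=
  forall B : set R, measurable B ->
    predictable_sets F [set p | 0 <= p.1 /\ B (X p.1 p.2)].

Definition continuous_paths (T : topologicalType) (X : R -> Omega -> T) : Prop :=
  \forall w \ae P, {within [set t | 0 <= t], continuous (fun t => X t w)}.

(* A is a version of <M>: right-continuous, predictable, increasing, null at
   0 and such that M^2 - A is a local martingale *)
Definition predictable_quadratic_variation (F : R -> set (set Omega))
    (M A : R -> Omega -> R) : Prop :=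
  [/\ predictable F A,
      \forall w \ae P,
        [/\ A 0 w = 0,
            forall s t, 0 <= s -> s <= t -> A s w <= A t w &
            forall t, 0 <= t -> A s w @[s --> t^'+] --> A t w] &
      local_martingale F (fun t w => M t w ^+ 2 - A t w)].

Definition modification (M M' : R -> Omega -> R) : Prop :=
  forall t, 0 <= t -> \forall w \ae P, M t w = M' t w.

(* A is (a version of) <M> := <M'>, M' being the continuous modification of M.
   M' is unique up to indistinguishability, and so is A. *)
Definition square_characteristic (F : R -> set (set Omega))
    (M A : R -> Omega -> R) : Prop :=
  exists M' : R -> Omega -> R,
    [/\ modification M M',
        continuous_paths M',
        locally_square_integrable_martingale F M' &
        predictable_quadratic_variation F M' A].

Section brownian.
Variable n : nat.
Implicit Type W : R -> Omega -> 'cV[R]_n.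

Definition history W (t : R) : set (set Omega) :=
  <<s [set A | exists s (B : set 'cV[R]_n),
         [/\ 0 <= s, s <= t, measurable B & A = W s @^-1` B]] >>.

(* The usual augmentation; for a complete P the P-negligible sets are events. *)
Definition completed_history W (t : R) : set (set Omega) :=
  <<s history W t `|` P.-negligible >>.

Definition standard_brownian_motion W : Prop :=
  [/\ forall t, 0 <= t -> measurable_fun setT (W t),
      \forall w \ae P, W 0 w = 0,
      continuous_paths W,
      (* W t - W s is independent of the past up to time s *)
      forall s t, 0 <= s -> s < t ->
        forall A (B : set 'cV[R]_n), history W s A -> measurable B ->
          P (A `&` [set w | B (W t w - W s w)]) =
          (P A * P [set w | B (W t w - W s w)%R])%E &
      (* W t - W s has law N(0, (t - s) I_n) *)
      forall s t, 0 <= s -> s < t ->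
        forall B : 'I_n -> set R, (forall i, measurable (B i)) ->
          P [set w | forall i, B i ((W t w - W s w) i ord0)] =
          (\prod_(i < n) normal_prob 0 (Num.sqrt (t - s)) (B i))%E].

End brownian.

End processes.

(* z : R^(n + n) is the pair (x, y) = (usubmx z, dsubmx z) *)
Definition cauchy_equation_ae (R : realType) (n m : nat)
    (f : 'cV[R]_n -> 'cV[R]_m) : Prop :=
  lebesgue_measurable_fun f /\
  \forall z \ae (lebesgue_cV R (n + n)),
    f (usubmx z + dsubmx z) = f (usubmx z) + f (dsubmx z).

Definition linear_ae (R : realType) (n m : nat)
    (f : 'cV[R]_n -> 'cV[R]_m) : Prop :=
  exists A : 'M[R]_(m, n), \forall x \ae (lebesgue_cV R n), f x = A *m x.

(* <f_j(W)> is determined up to indistinguishability, so asserting the bound for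
   some version A amounts to asserting it for every version. This predicate
   also holds for x |-> A x + b, and, W starting at 0, it depends on the value
   f 0; the assertions above do not. *)
Definition martingale_transform (d : measure_display) (Omega : measurableType d)
    (R : realType) (P : probability Omega R) (n m : nat)
    (W : R -> Omega -> 'cV[R]_n) (f : 'cV[R]_n -> 'cV[R]_m) : Prop :=
  [/\ lebesgue_measurable_fun f,
      vector_martingale P (completed_history P W) (fun t w => f (W t w)) &
      forall j : 'I_m, exists (C : R) (A : R -> Omega -> R),
        square_characteristic P (completed_history P W)
          (fun t w => f (W t w) j ord0) A /\
        \forall w \ae P, forall s t, 0 <= s -> s <= t ->
          A t w - C * t <= A s w - C * s].

(* Main.v *)
From HB Require Import structures.
Require Import Defs.
From mathcomp Require Import all_boot all_order all_algebra.
From mathcomp Require Import all_classical all_reals all_analysis.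
From mathcomp Require Import measurable_realfun ring lra.
Import Order.TTheory GRing.Theory Num.Theory.
Import numFieldNormedType.Exports.

Set Implicit Arguments.
Unset Strict Implicit.
Unset Printing Implicit Defensive.

Local Open Scope classical_set_scope.
Local Open Scope ring_scope.

(** The three assertions are shown equivalent along (i) <-> (iii) and, when
    f 0 = 0, (ii) -> (i) and (iii) -> (ii).

    (i) -> (iii). For a component h of f, replaced by a Borel representative, let
    c(x) be the almost everywhere constant value of y |-> h (y + x) - h y when
    there is one. The points x where it exists form a subgroup of R^n, by
    translation invariance of null sets, and by Fubini this subgroup contains
    almost every x, with c(x) = h x. A conull subgroup is everything, because
    each x is a difference of two of its points; so c is additive everywhere. As
    h is bounded on a set filling more than half of a large cube, c is bounded on
    the unit cube (a Steinhaus argument, [ae_increment_bounded]), and a bounded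
    additive function is linear ([additive_bounded_linear]).

    (ii) -> (i). Let g be a component of f. Since <g(W)>_t <= C t and g(W_0) = 0,
    localization and Fatou's lemma give E g(W_t)^2 <= |C| t
    ([square_characteristic_bound]). The martingale property says that E g(W_u) = 0
    and that g is invariant under the heat semigroup, g = g * p_u almost
    everywhere, p_u being the density of W_u ([martingale_heat_invariant]). So for
    almost all (x, y) and all integers u >= 1,
      g (x + y) - g x - g y = int g(z) q(z) dz,
      q(z) = p_u(z - x - y) - p_u(z - x) - p_u(z - y) + p_u(z).
    Completing the square gives p_u(z - a) p_u(z - b) / p_u(z) =
    exp(a.b / u) p_u(z - a - b), so that int q^2 / p_u is a signed sum of terms
    exp(a.b / u) whose expansion in 1/u begins at order 2. The second moment of g
    under p_u being O(u), the right-hand side is O(u^(-1/2)) by the Cauchy-Schwarz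
    inequality, and it vanishes in the limit ([heat_additive]). No smoothness of g
    and no stochastic calculus enter: this second difference of g takes the place
    of Liouville's theorem for the harmonic function g.

    (iii) -> (ii). Up to modification each component of f(W) is a.W for a vector
    a. Independence and Brownian scaling of the increments make a.W and
    (a.W)^2 - c t martingales, where c is the variance of a.W_1. So c t is the
    square characteristic, the constant times k being a localizing sequence
    ([quadratic_variation_linear_brownian]). *)

(** * Borel sets and Lebesgue measure on R^n *)

Section image_measure.
Context d1 d2 (T1 : measurableType d1) (T2 : measurableType d2) (R : realType).
Variables (mu : {measure set T1 -> \bar R}) (f : T1 -> T2).

(** The measure structure of a pushforward depends on a proof that f is
    measurable; naming that proof makes the structure available for functions
    such as W t, which are measurable for some t only. *)
Definition image_measure (mf : measurable_fun setT f) :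
  {measure set T2 -> \bar R}.
Proof. by refine (pushforward mu f : {measure set T2 -> \bar R}). Defined.

Lemma image_measureE mf A : image_measure mf A = mu (f @^-1` A).
Proof. by []. Qed.

End image_measure.

Section measurability.
Context (R : realType) d (T : measurableType d).

Lemma preimage_measurable d2 (T2 : measurableType d2) (f : T -> T2) A :
  measurable_fun setT f -> measurable A -> measurable (f @^-1` A).
Proof. by move=> mf mA; rewrite -[X in measurable X]setTI; exact: mf. Qed.

Lemma measurable_cV_entry n (f : T -> 'cV[R]_n) i :
  measurable_fun setT f -> measurable_fun setT (fun z => f z i ord0).
Proof. by move=> mf; exact: measurableT_comp (measurable_cV_coord i) mf. Qed.

Lemma measurable_cVD n (f g : T -> 'cV[R]_n) :
  measurable_fun setT f -> measurable_fun setT g ->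
  measurable_fun setT (fun z => f z + g z).
Proof.
move=> mf mg; apply: measurable_fun_cV => i.
rewrite (_ : _ \o _ = fun z => f z i ord0 + g z i ord0); last first.
  by apply/funext => z; rewrite /cV_coord/= mxE.
by apply: measurable_funD; exact: measurable_cV_entry.
Qed.

Lemma measurable_cVZ n (f : T -> 'cV[R]_n) c :
  measurable_fun setT f -> measurable_fun setT (fun z => c *: f z).
Proof.
move=> mf; apply: measurable_fun_cV => i.
rewrite (_ : _ \o _ = fun z => c * f z i ord0); last first.
  by apply/funext => z; rewrite /cV_coord/= mxE.
by apply: measurable_funM => //; exact: measurable_cV_entry.
Qed.

Lemma measurable_cVB n (f g : T -> 'cV[R]_n) :
  measurable_fun setT f -> measurable_fun setT g ->
  measurable_fun setT (fun z => f z - g z).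
Proof.
move=> mf mg; under eq_fun do rewrite -scaleN1r.
by apply: measurable_cVD => //; exact: measurable_cVZ.
Qed.

Lemma measurable_mulmx n m (A : 'M[R]_(m, n)) (f : T -> 'cV[R]_n) :
  measurable_fun setT f -> measurable_fun setT (fun z => A *m f z).
Proof.
move=> mf; apply: measurable_fun_cV => i.
rewrite (_ : _ \o _ = fun z => \sum_k A i k * f z k ord0); last first.
  by apply/funext => z; rewrite /cV_coord/= mxE.
apply: measurable_sum => k.
by apply: measurable_funM => //; exact: measurable_cV_entry.
Qed.

Lemma measurable_col_mx n m (f : T -> 'cV[R]_n) (g : T -> 'cV[R]_m) :
  measurable_fun setT f -> measurable_fun setT g ->
  measurable_fun setT (fun z => col_mx (f z) (g z)).
Proof.
move=> mf mg; apply: measurable_fun_cV => i; rewrite -(splitK i).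
case: (fintype.split i) => j /=.
  rewrite (_ : _ \o _ = fun z => f z j ord0); first exact: measurable_cV_entry.
  by apply/funext => z; rewrite /cV_coord/= col_mxEu.
rewrite (_ : _ \o _ = fun z => g z j ord0); first exact: measurable_cV_entry.
by apply/funext => z; rewrite /cV_coord/= col_mxEd.
Qed.

Lemma measurable_usubmx n m (f : T -> 'cV[R]_(n + m)) :
  measurable_fun setT f -> measurable_fun setT (fun z => usubmx (f z)).
Proof.
move=> mf; apply: measurable_fun_cV => i.
rewrite (_ : _ \o _ = fun z => f z (lshift m i) ord0); last first.
  by apply/funext => z; rewrite /cV_coord/= mxE.
exact: measurable_cV_entry.
Qed.

Lemma measurable_dsubmx n m (f : T -> 'cV[R]_(n + m)) :
  measurable_fun setT f -> measurable_fun setT (fun z => dsubmx (f z)).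
Proof.
move=> mf; apply: measurable_fun_cV => i.
rewrite (_ : _ \o _ = fun z => f z (rshift n i) ord0); last first.
  by apply/funext => z; rewrite /cV_coord/= mxE.
exact: measurable_cV_entry.
Qed.

End measurability.

Section boxes.
Context (R : realType) (n : nat).

Definition box (B : 'I_n -> set R) : set 'cV[R]_n :=
  [set x | forall i, B i (x i ord0)].

Definition cube (a b : R) : set 'cV[R]_n := box (fun=> `[a, b]%classic).

Lemma boxT : box (fun=> setT) = setT.
Proof. by apply/seteqP; split. Qed.

Lemma measurable_box B : (forall i, measurable (B i)) -> measurable (box B).
Proof.
move=> mB; rewrite (_ : box B = \bigcap_(i in [set: 'I_n]) (cV_coord i @^-1` B i)).
  apply: fin_bigcap_measurable; first exact: (@finite_finset (ordinal n)).
  by move=> i _; apply: preimage_measurable => //; exact: measurable_cV_coord.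
by apply/seteqP; split => x /= h i; [move=> _; exact: h|exact: h].
Qed.

Lemma measurable_cV_boxE : (measurable : set (set 'cV[R]_n)) =
  <<s [set box B | B in [set B | forall i, measurable (B i)]] >>.
Proof.
apply/seteqP; split; last first.
  apply: smallest_sub; first exact: sigma_algebra_measurable.
  by move=> _ [B mB <-]; exact: measurable_box.
apply: smallest_sub; first exact: smallest_sigma_algebra.
rewrite -bigcup_seq => _ [i _ [C mC <-]]; apply: sub_sigma_algebra.
exists (fun j => if j == i then C else setT) => [j /=|]; first by case: ifP.
apply/seteqP; split => x /=.
  by move=> /(_ i); rewrite eqxx.
by move=> [_ Cx] j; case: eqP => // ->.
Qed.

Lemma box_cover :
  \bigcup_(k : nat) cube (- k%:R) k%:R = [set: 'cV[R]_n].
Proof.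
apply/seteqP; split => // x _.
have [k hk] : exists k : nat, forall i, `|x i ord0| <= k%:R.
  exists (\sum_i (Num.bound `|x i ord0|)%R)%N => i.
  apply: (@le_trans _ _ (Num.bound `|x i ord0|)%:R).
    by apply/ltW/archi_boundP.
  by rewrite ler_nat (bigD1 i)//= leq_addr.
by exists k => // i /=; rewrite in_itv/= -ler_norml.
Qed.

(** Boxes form a pi-system generating the Borel sets. *)
Lemma eq_measure_box (mu nu : {measure set 'cV[R]_n -> \bar R}) :
  (forall B, (forall i, measurable (B i)) -> mu (box B) = nu (box B)) ->
  (forall k : nat, (mu (cube (- k%:R)%R k%:R%R) < +oo)%E) ->
  forall A, measurable A -> mu A = nu A.
Proof.
move=> mn fin A mA.
apply: (measure_unique [set box B | B in [set B | forall i, measurable (B i)]]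
  (fun k : nat => cube (- k%:R) k%:R)) => //.
- exact: measurable_cV_boxE.
- move=> _ _ [B mB <-] [C mC <-]; exists (fun i => B i `&` C i).
    by move=> i; exact: measurableI.
  apply/seteqP; split => x /=.
    by move=> h; split => i; have [] := h i.
  by move=> [h1 h2] i; split.
- by move=> k; exists (fun=> `[- k%:R, k%:R]%classic).
- exact: box_cover.
- by move=> _ [B mB <-]; exact: mn.
Qed.

Lemma lebesgue_cV_boxE B : (forall i, measurable (B i)) ->
  lebesgue_cV R n (box B) = (\prod_(i < n) lebesgue_measure (B i))%E.
Proof. exact: lebesgue_cV_box. Qed.

Lemma lebesgue_cube (a b : R) : a <= b ->
  lebesgue_cV R n (cube a b) = ((b - a) ^+ n)%:E.
Proof.
move=> ab; rewrite /cube lebesgue_cV_boxE//.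
rewrite (eq_bigr (fun=> (b - a)%:E)); last first.
  move=> i _; rewrite lebesgue_measure_itv/= lte_fin.
  by move: ab; rewrite le_eqVlt => /predU1P[->|->]; rewrite ?ltxx ?subrr// EFinB.
by rewrite prodEFin prodr_const card_ord.
Qed.

End boxes.

Section affine_change_of_variable.
Context (R : realType).

Lemma measurable_affine (c b : R) :
  measurable_fun setT (fun x : measurableTypeR R => c * x + b : measurableTypeR R).
Proof. by apply: measurable_funD => //; exact: measurable_funM. Qed.

(** Lebesgue measure is determined by its values on the intervals ]x, y], whose
    preimages are intervals too; c < 0 exchanges the open and the closed end. *)
Lemma lebesgue_measure_affine (c b : R) (A : set R) : c != 0 -> measurable A ->
  lebesgue_measure ((fun x => c * x + b) @^-1` A) =
  (`|c|^-1%:E * lebesgue_measure A)%E.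
Proof.
move=> c0 mA; have c1 : 0 < `|c| by rewrite normr_gt0.
pose mu := mscale (NngNum (normr_ge0 c))
  (image_measure (@lebesgue_measure R) (measurable_affine c b)).
have -> : (lebesgue_measure A =
    `|c|%:E * lebesgue_measure ((fun x => (c * x + b)%R) @^-1` A))%E.
  apply: (@lebesgue_measure_unique R mu) => //= _ [[x y] _ <-].
  rewrite /mu /mscale/= image_measureE.
  have [cp|cn|/eqP] := ltgtP 0 c; last by rewrite eq_sym (negbTE c0).
  - rewrite (_ : _ @^-1` _ = `](x - b) / c, (y - b) / c]%classic); last first.
      apply/seteqP; split => z /=; rewrite !in_itv/= ltr_pdivrMr// ler_pdivlMr//;
      by rewrite ltrBlDr lerBrDr mulrC.
    rewrite [LHS]lebesgue_measure_itv [X in (_ * X)%E]lebesgue_measure_itv/=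
      !lte_fin ltr_pM2r ?invr_gt0// ltrD2r.
    case: ifP; rewrite ?mule0// -!EFinB -EFinM gtr0_norm//.
    by move=> _; congr (_%:E); field.
  - rewrite (_ : _ @^-1` _ = `[(y - b) / c, (x - b) / c[%classic); last first.
      apply/seteqP; split => z /=; rewrite !in_itv/= ltr_ndivlMr// ler_ndivrMr//;
      by rewrite ltrBlDr lerBrDr mulrC andbC.
    rewrite [LHS]lebesgue_measure_itv [X in (_ * X)%E]lebesgue_measure_itv/=
      !lte_fin ltr_nM2r ?invr_lt0// ltrD2r.
    case: ifP; rewrite ?mule0// -!EFinB -EFinM ltr0_norm//.
    by move=> _; congr (_%:E); field.
  exact: measurable_affine.
by rewrite muleA -EFinM mulVf ?mul1e ?gt_eqF.
Qed.

End affine_change_of_variable.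

Section lebesgue_cV_affine.
Context (R : realType) (n : nat).
Local Notation lam := (lebesgue_cV R n).

Lemma lebesgue_cV_cube_fin (k : nat) :
  (lam (cube (- (k%:R : R))%R (k%:R : R)%R) < +oo)%E.
Proof. by rewrite lebesgue_cube ?ltry// (le_trans _ (ler0n R k))// oppr_le0 ler0n. Qed.

Lemma measurable_cV_affine (c : R) (a : 'cV[R]_n) :
  measurable_fun setT (fun x : 'cV[R]_n => c *: x + a).
Proof. by apply: measurable_cVD => //; exact: measurable_cVZ. Qed.

(** On a box this is the one-dimensional formula in each coordinate. *)
Lemma lebesgue_cV_affine (c : R) (a : 'cV[R]_n) A : c != 0 -> measurable A ->
  lam ((fun x => c *: x + a) @^-1` A) = ((`|c|^-1 ^+ n)%:E * lam A)%E.
Proof.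
move=> c0 mA; have cn0 : 0 <= `|c|^-1 ^+ n by rewrite exprn_ge0// invr_ge0.
rewrite -(image_measureE _ (measurable_cV_affine c a)).
rewrite -[RHS]/(mscale (NngNum cn0) lam A).
apply/esym; apply: eq_measure_box mA => [B mB|k]; last first.
  by rewrite lte_mul_pinfty ?lee_fin//; exact: lebesgue_cV_cube_fin.
rewrite image_measureE -[LHS]/(_ * _)%E [X in (_ * X)%E](lebesgue_cV_boxE mB).
rewrite (_ : _ @^-1` _ = box (fun i => (fun x => c * x + a i ord0) @^-1` B i)).
  rewrite [RHS]lebesgue_cV_boxE; last first.
    by move=> i; apply: preimage_measurable => //; exact: measurable_affine.
  under [RHS]eq_bigr do rewrite lebesgue_measure_affine//.
  by rewrite big_split/= prodEFin prodr_const card_ord.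
by apply/seteqP; split => x /= h i; have := h i; rewrite /= !mxE.
Qed.

Lemma ge0_integral_affine (c : R) (a : 'cV[R]_n) (f : 'cV[R]_n -> \bar R) :
  c != 0 -> measurable_fun setT f -> (forall x, 0 <= f x)%E ->
  (\int[lam]_x f (c *: x + a)%R = (`|c|^-1 ^+ n)%:E * \int[lam]_x f x)%E.
Proof.
move=> c0 mf f0; have cn0 : 0 <= `|c|^-1 ^+ n by rewrite exprn_ge0// invr_ge0.
have := ge0_integral_pushforward (measurable_cV_affine c a) lam measurableT mf (in1W f0).
rewrite preimage_setT => <-.
rewrite -(@ge0_integral_mscale _ _ _ lam setT measurableT (NngNum cn0))//.
apply: eq_measure_integral => [|mt A mA _]; first exact: measurable_cV_affine.
exact: lebesgue_cV_affine.
Qed.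

Lemma integral_affine (c : R) (a : 'cV[R]_n) (f : 'cV[R]_n -> \bar R) :
  c != 0 -> lam.-integrable setT f ->
  (\int[lam]_x f (c *: x + a)%R = (`|c|^-1 ^+ n)%:E * \int[lam]_x f x)%E.
Proof.
move=> c0 fi; have mf := measurable_int _ fi.
rewrite integralE [in RHS]integralE muleBr//; last first.
  by apply: fin_num_adde_defr; apply: integrable_pos_fin_num.
congr (_ - _)%E.
- rewrite -(ge0_integral_affine a c0 (measurable_funepos mf))//.
  by apply: eq_integral => x _; rewrite !funeposE.
- rewrite -(ge0_integral_affine a c0 (measurable_funeneg mf))//.
  by apply: eq_integral => x _; rewrite !funenegE.
Qed.

Lemma measurable_translation (a : 'cV[R]_n) :
  measurable_fun setT (fun x : 'cV[R]_n => x + a).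
Proof. exact: measurable_cVD. Qed.

Lemma lebesgue_cV_translation (a : 'cV[R]_n) A : measurable A ->
  lam ((fun x => x + a) @^-1` A) = lam A.
Proof.
move=> mA; have := lebesgue_cV_affine a (oner_neq0 R) mA.
rewrite normr1 invr1 expr1n mul1e => <-; apply: (congr1 (fun B => lam (B @^-1` A))).
by apply/funext => x; rewrite scale1r.
Qed.

Lemma ge0_integral_translation (a : 'cV[R]_n) (f : 'cV[R]_n -> \bar R) :
  measurable_fun setT f -> (forall x, 0 <= f x)%E ->
  (\int[lam]_x f (x + a)%R = \int[lam]_x f x)%E.
Proof.
move=> mf f0; have := ge0_integral_affine a (oner_neq0 R) mf f0.
rewrite normr1 invr1 expr1n mul1e => <-.
by apply: eq_integral => x _; rewrite scale1r.
Qed.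

Lemma integrable_translation (a : 'cV[R]_n) (f : 'cV[R]_n -> \bar R) :
  lam.-integrable setT f -> lam.-integrable setT (fun x => f (x + a)).
Proof.
move=> /integrableP[mf fi]; apply/integrableP; split.
  exact: measurableT_comp mf (measurable_translation a).
rewrite (ge0_integral_translation a (f := fun x => `|f x|%E))//.
exact: measurableT_comp.
Qed.

Lemma integral_translation (a : 'cV[R]_n) (f : 'cV[R]_n -> \bar R) :
  measurable_fun setT f ->
  (\int[lam]_x f (x + a)%R = \int[lam]_x f x)%E.
Proof.
move=> mf; rewrite integralE [RHS]integralE; congr (_ - _)%E.
- rewrite -(ge0_integral_translation a (measurable_funepos mf))//.
  by apply: eq_integral => x _; rewrite !funeposE.
- rewrite -(ge0_integral_translation a (measurable_funeneg mf))//.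
  by apply: eq_integral => x _; rewrite !funenegE.
Qed.

Lemma negligible_translation (a : 'cV[R]_n) A :
  lam.-negligible A -> lam.-negligible ((fun x => x + a) @^-1` A).
Proof.
move=> [B [mB B0 AB]]; exists ((fun x => x + a) @^-1` B); split.
- exact: preimage_measurable (measurable_translation a) mB.
- by rewrite lebesgue_cV_translation.
- by move=> x; exact: AB.
Qed.

Lemma ae_translation (a : 'cV[R]_n) (P : 'cV[R]_n -> Prop) :
  (\forall x \ae lam, P x) -> \forall x \ae lam, P (x + a).
Proof. exact: negligible_translation. Qed.

End lebesgue_cV_affine.

(** * Null sets of R^(n + m) *)

Section product_null_sets.
Context d1 d2 (T1 : measurableType d1) (T2 : measurableType d2) (R : realType).
Variables (m1 : {sigma_finite_measure set T1 -> \bar R}).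
Variables (m2 : {sigma_finite_measure set T2 -> \bar R}).
Local Open Scope ereal_scope.

Lemma product_measure_eq0 (N : set (T1 * T2)) : measurable N ->
  (m1 \x m2) N = 0 <-> \forall x \ae m1, m2 (xsection N x) = 0.
Proof.
move=> mN; have mphi := measurable_fun_xsection m2 mN.
have phi0 x : 0 <= (m2 \o xsection N) x by exact: measure_ge0.
have -> : ((m1 \x m2) N = 0) =
    (\int[m1]_x `|(m2 \o xsection N) x| = 0).
  by rewrite /product_measure1; under [in RHS]eq_integral do rewrite gee0_abs//.
split=> [|ae0].
  move/(ae_eq_integral_abs m1 measurableT mphi).
  by apply: filterS => x; exact.
apply/(ae_eq_integral_abs m1 measurableT mphi).
by apply: filterS ae0 => x /= ->.
Qed.

End product_null_sets.

Section lebesgue_cV_product.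
Context (R : realType) (n m : nat).
Local Notation lam := (lebesgue_cV R).

Definition cV_pair (z : 'cV[R]_n * 'cV[R]_m) : 'cV[R]_(n + m) := col_mx z.1 z.2.

Lemma measurable_cV_pair : measurable_fun setT cV_pair.
Proof. exact: measurable_col_mx. Qed.

(** Both measures give a box the product of its sides. *)
Lemma lebesgue_cV_pair (A : set 'cV[R]_(n + m)) : measurable A ->
  lam (n + m)%N A = (lam n \x lam m)%E (cV_pair @^-1` A).
Proof.
move=> mA; rewrite -(image_measureE _ measurable_cV_pair).
apply: eq_measure_box mA => [B mB|k]; last exact: lebesgue_cV_cube_fin.
rewrite [LHS](lebesgue_cV_boxE mB) image_measureE big_split_ord/=.
rewrite -[X in (X * _)%E]lebesgue_cV_boxE// -[X in (_ * X)%E]lebesgue_cV_boxE//.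
rewrite (_ : _ @^-1` _ = box (fun i => B (lshift m i)) `*` box (fun i => B (rshift n i))).
  by rewrite product_measure1E//; apply: measurable_box.
apply/seteqP; split => -[x y]/=.
  move=> h; split => i.
    by have := h (lshift m i); rewrite /cV_pair/= col_mxEu.
  by have := h (rshift n i); rewrite /cV_pair/= col_mxEd.
move=> [hx hy] i; rewrite -(splitK i) /cV_pair; case: (fintype.split i) => j /=.
  by rewrite col_mxEu; exact: hx.
by rewrite col_mxEd; exact: hy.
Qed.

Lemma lebesgue_cV_eq0 (A : set 'cV[R]_(n + m)) : measurable A ->
  lam (n + m)%N A = 0%E <->
  \forall x \ae (lam n), lam m [set y | A (col_mx x y)] = 0%E.
Proof.
move=> mA; rewrite lebesgue_cV_pair// product_measure_eq0.
  by split; apply: filterS => x <-; congr (lam m _); apply/seteqP; split => y;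
    rewrite /xsection/= inE.
exact: preimage_measurable measurable_cV_pair mA.
Qed.

Lemma ae_cV_pair (P : 'cV[R]_(n + m) -> Prop) :
  (\forall z \ae (lam (n + m)%N), P z) ->
  \forall x \ae (lam n), \forall y \ae (lam m), P (col_mx x y).
Proof.
move=> [N [mN /(lebesgue_cV_eq0 mN) N0 PN]]; apply: filterS N0 => x Nx0.
exists [set y | N (col_mx x y)]; split => //; last by move=> y; exact: PN.
apply: preimage_measurable mN.
exact: measurable_col_mx (measurable_cst x) (@measurable_id _ _ setT).
Qed.

Lemma ae_usubmx (P : 'cV[R]_n -> Prop) :
  (\forall x \ae (lam n), P x) -> \forall z \ae (lam (n + m)%N), P (usubmx z).
Proof.
move=> [N [mN N0 PN]]; exists (usubmx @^-1` N); split => [||z]; last exact: PN.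
  by apply: preimage_measurable mN; exact: measurable_usubmx.
apply/lebesgue_cV_eq0; first by apply: preimage_measurable mN; exact: measurable_usubmx.
exists N; split => // x /=; apply: contra_notP => Nx.
rewrite (_ : [set _ | _] = set0)//.
by apply/seteqP; split => y //=; rewrite col_mxKu.
Qed.

Lemma ae_dsubmx (P : 'cV[R]_m -> Prop) :
  (\forall x \ae (lam m), P x) -> \forall z \ae (lam (n + m)%N), P (dsubmx z).
Proof.
move=> [N [mN N0 PN]]; exists (dsubmx @^-1` N); split => [||z]; last exact: PN.
  by apply: preimage_measurable mN; exact: measurable_dsubmx.
apply/lebesgue_cV_eq0; first by apply: preimage_measurable mN; exact: measurable_dsubmx.
apply: aeW => x; rewrite (_ : [set _ | _] = N)//.
by apply/seteqP; split => y /=; rewrite col_mxKd.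
Qed.

End lebesgue_cV_product.

(** The slices at fixed x of the exceptional set are translates of a null set. *)
Lemma ae_addsubmx (R : realType) (n : nat) (P : 'cV[R]_n -> Prop) :
  (\forall x \ae (lebesgue_cV R n), P x) ->
  \forall z \ae (lebesgue_cV R (n + n)), P (usubmx z + dsubmx z).
Proof.
have mD : measurable_fun setT (fun z : 'cV[R]_(n + n) => usubmx z + dsubmx z).
  by apply: measurable_cVD; [exact: measurable_usubmx|exact: measurable_dsubmx].
move=> [N [mN N0 PN]].
exists ((fun z => usubmx z + dsubmx z) @^-1` N); split => [||z]; last exact: PN.
  exact: preimage_measurable mD mN.
apply/lebesgue_cV_eq0; first exact: preimage_measurable mD mN.
apply: aeW => x; rewrite -[RHS]N0 -(lebesgue_cV_translation x mN).
by congr (lebesgue_cV R n _); apply/seteqP; split => y /=; rewrite col_mxKd col_mxKu addrC.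
Qed.

(** * Borel representatives *)

Section borel_representative.
Context (R : realType) (n : nat).
Local Notation lam := (lebesgue_cV R n).

Lemma completed_borel_mod (A : set 'cV[R]_n) : completed_algebra_gen lam A ->
  exists2 B, measurable B & \forall x \ae lam, A x <-> B x.
Proof.
move=> [B mB [N [N' [mN' N0 NN']]] <-]; exists B => //.
exists N'; split => // x /= h; apply: NN'; apply: contrapT => Nx; apply: h.
by split => [[]//|]; left.
Qed.

Lemma borel_mod_completed (A B : set 'cV[R]_n) : measurable B ->
  (\forall x \ae lam, A x <-> B x) -> completed_algebra_gen lam A.
Proof.
move=> mB [N [mN N0 AB']]; exists (B `\` N); first exact: measurableD.
exists (A `&` N); first by exists N; split => // x [].
have AB x : ~ N x -> (A x <-> B x).
  by move=> Nx; apply: contrapT => h; apply: Nx; exact: AB'.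
apply/seteqP; split => x /=.
  by move=> [[Bx /AB [_]]|[]//]; exact.
by move=> Ax; have [Nx|Nx] := pselect (N x); [right|left; split => //; exact/AB].
Qed.

(** Redefining f on a null set that absorbs the countably many exceptional sets
    attached to the rays with rational endpoints makes it Borel. *)
Lemma borel_representative (g : 'cV[R]_n -> R) :
  (forall B, measurable B -> completed_algebra_gen lam (g @^-1` B)) ->
  exists2 h, measurable_fun setT h & \forall x \ae lam, g x = h x.
Proof.
move=> mg.
have /choice[B HB] : forall q : rat, exists B : set 'cV[R]_n,
    measurable B /\ \forall x \ae lam, g x < ratr q <-> B x.
  move=> q; have := mg `]-oo, (ratr q)[%classic (measurable_itv _).
  move=> /completed_borel_mod[B mB AB]; exists B; split => //.
have mB q : measurable (B q) by have [] := HB q.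
have [N [mN N0 gN]] : \forall x \ae lam, forall k q, unpickle k = Some q ->
    (g x < ratr q <-> B q x).
  apply: ae_foralln => k; case: (unpickle k) => [q|]; last exact: aeW.
  by have [_] := HB q; apply: filterS => x Bx _ [<-].
have gB q x : ~ N x -> (g x < ratr q <-> B q x).
  move=> Nx; suff : forall k q, unpickle k = Some q -> (g x < ratr q <-> B q x).
    by move=> /(_ (pickle q) q); apply; rewrite pickleK.
  by apply: contrapT => h; apply: Nx; exact: gN.
exists (fun x => if x \in N then 0 else g x); last first.
  exists N; split => // x; apply: contra_notP => Nx /=.
  by rewrite memNset.
apply: (measurability _ (RGenInftyO.measurableE R)) => _ [_ [r ->] <-].
rewrite setTI (_ : _ @^-1` _ =
    (\bigcup_(q in [set q : rat | ratr q < r]) B q `\` N) `|`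
    (if 0 < r then N else set0)).
  apply: measurableU; last by case: ifP.
  apply: measurableD => //; rewrite bigcup_mkcond.
  by apply: bigcupT_measurable_rat => q; case: ifP.
apply/seteqP; split => x /=; rewrite in_itv/=.
  case: ifPn => [xN r0|/negP xN gr]; first by right; rewrite r0; rewrite inE in xN.
  have Nx : ~ N x by move=> /mem_set.
  have [q] := rat_in_itvoo gr; rewrite in_itv/= => /andP[gq qr].
  by left; split => //; exists q => //; apply/(gB q x Nx).
move=> [[[q /= qr Bq] Nx]|].
  by rewrite memNset//; apply: lt_trans qr; apply/(gB q x Nx).
by case: ifPn => // r0 Nx; rewrite mem_set.
Qed.
End borel_representative.

(** * Almost everywhere additive functions *)

(** Writing phi t - t phi 1 as psi t, psi has period 1, hence is bounded on R,
    and psi (N t) = N psi t then forces psi = 0. *)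
Lemma additive_bounded_linear (R : realType) (phi : R -> R) (K : R) :
  {morph phi : x y / x + y} -> (forall t, `|t| <= 1 -> `|phi t| <= K) ->
  forall t, phi t = t * phi 1.
Proof.
move=> phiD phiK.
have psiD : {morph (fun t => phi t - t * phi 1) : x y / x + y}.
  by move=> x y; rewrite phiD; ring.
move: psiD; set psi := fun t => _ => psiD.
have psi0 : psi 0 = 0 by have := psiD 0 0; rewrite addr0; lra.
have psi1 : psi 1 = 0 by rewrite /psi mul1r subrr.
have psiN x : psi (- x) = - psi x.
  by apply/eqP; rewrite -addr_eq0 -psiD addNr psi0.
have psiMn x k : psi (x *+ k) = psi x *+ k.
  by elim: k => [|k IH]; rewrite ?mulr0n// !mulrS psiD IH.
have psiZ (z : int) : psi z%:~R = 0.
  by case: z => k; rewrite ?NegzE ?mulrNz ?psiN -pmulrn psiMn psi1 mul0rn ?oppr0.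
have psi_le x : `|psi x| <= K + `|phi 1|.
  have -> : psi x = psi (x - (Num.floor x)%:~R) by rewrite psiD psiN psiZ subr0.
  set t := x - _; have /andP[t0 t1] : 0 <= t < 1.
    by have := floor_itv x; rewrite intrD /t; lra.
  have tle1 : `|t| <= 1 by rewrite ger0_norm// ltW.
  rewrite /psi (le_trans (ler_normB _ _))// lerD ?phiK//.
  by rewrite normrM ler_piMl.
move=> t; apply/eqP; rewrite -subr_eq0; apply/eqP; rewrite -/(psi t).
apply/eqP; apply: contrapT => /negP; rewrite -normr_gt0 => pt.
have [k] : exists k : nat, (K + `|phi 1|) / `|psi t| < k%:R.
  exists (Num.bound ((K + `|phi 1|) / `|psi t|)); apply: archi_boundP.
  by rewrite divr_ge0// (le_trans (normr_ge0 (psi 0))).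
rewrite ltr_pdivrMr// => /lt_le_trans/(_ _) h.
have := psi_le (t *+ k); rewrite psiMn normrMn -mulr_natl leNgt => /negP; apply.
exact: h.
Qed.

(** Otherwise E and its translate would be disjoint up to a null set, and their
    equal measures would add up to at most the measure of Q. *)
Lemma meets_translate (R : realType) (n : nat) (E Q N : set 'cV[R]_n)
    (x : 'cV[R]_n) :
  measurable E -> measurable Q -> (lebesgue_cV R n).-negligible N ->
  E `<=` Q -> (fun y => y + x) @^-1` E `<=` Q ->
  (lebesgue_cV R n Q < lebesgue_cV R n E + lebesgue_cV R n E)%E ->
  exists y, [/\ E y, E (y + x) & ~ N y].
Proof.
move=> mE mQ [N' [mN' N0 NN']] EQ ExQ; apply: contraPP => h.
have mEx : measurable ((fun y => y + x) @^-1` E).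
  exact: preimage_measurable (measurable_translation x) mE.
have tE : (E `\` N') `&` (((fun y => y + x) @^-1` E) `\` N') = set0.
  apply/seteqP; split => // y [[Ey nNy] [Exy _]]; apply: h; exists y; split => //.
  by move=> /NN'.
apply/negP; rewrite -leNgt.
have DE A : measurable A -> lebesgue_cV R n A = lebesgue_cV R n (A `\` N').
  move=> mA; apply/eqP; rewrite eq_le; apply/andP; split; last first.
    by apply: le_measure; rewrite ?inE//; exact: measurableD.
  rewrite -[leRHS]adde0 -N0 -measureU//; last 2 first.
  - exact: measurableD.
  - by apply/seteqP; split => // y [[]].
  apply: le_measure; rewrite ?inE//; first by apply: measurableU => //; exact: measurableD.
  by move=> y Ay; have [|] := pselect (N' y); [right|left].
rewrite -{2}(lebesgue_cV_translation x mE) (DE _ mE) (DE _ mEx) -measureU//.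
- apply: le_measure; rewrite ?inE//; first by apply: measurableU; apply: measurableD.
  by move=> y [[/EQ]|[/ExQ]].
- exact: measurableD.
- exact: measurableD.
Qed.

Lemma bernoulli_ineq (R : realType) (t : R) (k : nat) :
  0 <= t <= 1 -> 1 - k%:R * t <= (1 - t) ^+ k.
Proof.
move=> /andP[t0 t1]; elim: k => [|k IH]; first by rewrite expr0 mul0r subr0.
rewrite exprS; apply: (@le_trans _ _ ((1 - t) * (1 - k%:R * t))).
  have : 0 <= k%:R * t ^+ 2 by rewrite mulr_ge0// sqr_ge0.
  by rewrite -natr1; lra.
by rewrite ler_wpM2l// subr_ge0.
Qed.

Lemma lebesgue_cV_gt0 (R : realType) (n : nat) : (0 < lebesgue_cV R n setT)%E.
Proof.
apply: (@lt_le_trans _ _ (lebesgue_cV R n (cube (0 : R) 1))).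
  by rewrite lebesgue_cube// subr0 expr1n lte_fin.
by apply: le_measure; rewrite ?inE//; exact: measurable_box.
Qed.

Lemma ae_ex (R : realType) (n : nat) (P : 'cV[R]_n -> Prop) :
  (\forall x \ae lebesgue_cV R n, P x) -> exists x, P x.
Proof.
move=> aeP; have /ae_properfilter_algebraOfSetsType F := lebesgue_cV_gt0 R n.
exact: (@filter_ex _ _ F _ aeP).
Qed.

Section additive_ae.
Context (R : realType) (n : nat) (h : 'cV[R]_n -> R).
Local Notation lam := (lebesgue_cV R n).

(** When h is additive almost everywhere such a c exists for every x, and
    x |-> c is a modification of h that is additive everywhere. *)
Definition ae_increment (x : 'cV[R]_n) (c : R) : Prop :=
  \forall y \ae lam, h (y + x) - h y = c.

Lemma ae_increment_uniq x c c' :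
  ae_increment x c -> ae_increment x c' -> c = c'.
Proof. by move=> xc xc'; have [y [<- <-]] := ae_ex (filterI xc xc'). Qed.

Lemma ae_incrementD x x' c c' : ae_increment x c -> ae_increment x' c' ->
  ae_increment (x + x') (c + c').
Proof.
move=> /(ae_translation x') xc; apply: filterS2 xc => y.
by rewrite -addrA (addrC x') => <- <-; ring.
Qed.

Lemma ae_incrementN x c : ae_increment x c -> ae_increment (- x) (- c).
Proof.
move=> /(ae_translation (- x)); apply: filterS => y.
by rewrite subrK => <-; rewrite opprB.
Qed.

Hypothesis h_additive :
  \forall z \ae (lebesgue_cV R (n + n)),
    h (usubmx z + dsubmx z) = h (usubmx z) + h (dsubmx z).

Lemma ae_increment_self : \forall x \ae lam, ae_increment x (h x).
Proof.
apply: filterS (ae_cV_pair h_additive) => x; apply: filterS => y.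
by rewrite col_mxKu col_mxKd addrC => ->; rewrite addrK.
Qed.

(** Every x is a difference of two points of the conull set on which the
    increment is known to be constant. *)
Lemma ae_increment_total x : exists c, ae_increment x c.
Proof.
have [y [yc yxc]] :=
  ae_ex (filterI ae_increment_self (ae_translation x ae_increment_self)).
exists (h (y + x) + - h y).
have := ae_incrementD yxc (ae_incrementN yc).
by rewrite addrAC addrN add0r.
Qed.

Hypothesis mh : measurable_fun setT h.

(** The cube [-2n, 2n]^n has more than half the volume of [-2n-1, 2n+1]^n, hence
    so does the part of it where |h| <= k, for k large; h (y + x) - h y is at
    most 2 k when y and y + x both lie in that part. *)
Lemma ae_increment_bounded : exists K, forall (x : 'cV[R]_n) c,
  (forall i, `|x i ord0| <= 1) -> ae_increment x c -> `|c| <= K.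
Proof.
pose L : R := n.*2%:R; have L0 : 0 <= L by rewrite ler0n.
pose E (k : nat) := cube (- L) L `&` [set y : 'cV[R]_n | `|h y| <= k%:R].
have mE k : measurable (E k).
  apply: measurableI; first exact: measurable_box.
  rewrite (_ : [set _ | _] = (fun y => `|h y|) @^-1` `]-oo, k%:R]).
    by apply: preimage_measurable => //; exact: measurableT_comp.
  by apply/seteqP; split => y /=; rewrite in_itv.
have ndE : {homo E : i j / (i <= j)%N >-> (i <= j)%O}.
  move=> i j ij; apply/subsetPset => y [Qy /= hy]; split => //=.
  by rewrite (le_trans hy)// ler_nat.
have UE : \bigcup_k E k = cube (- L) L.
  apply/seteqP; split => [y [k _ []]//|y Qy].
  exists (Num.bound `|h y|) => //; split => //=.
  exact/ltW/archi_boundP.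
have LL : 0 < L + 1 by rewrite ltr_wpDl.
pose V := (2 * (L + 1)) ^+ n; pose V' := (2 * L) ^+ n.
have VV' : V / 2 < V'.
  rewrite /V /V' !exprMn -mulrA ltr_pM2l ?exprn_gt0//.
  have -> : L ^+ n = (L + 1) ^+ n * (1 - (L + 1)^-1) ^+ n.
    rewrite -exprMn; congr (_ ^+ n).
    by rewrite mulrBr mulr1 divff ?gt_eqF// addrK.
  rewrite ltr_pM2l ?exprn_gt0//.
  apply: lt_le_trans (bernoulli_ineq _ _); last first.
    by rewrite invr_ge0 ltW//= invf_le1// lerDr.
  rewrite ltrBrDr -ltrBrDl (_ : 1 - 2^-1 = 2^-1); last by field.
  rewrite ltr_pdivrMr// /L -muln2 natrM; lra.
have [k Ek] : exists k, ((V / 2)%:E < lam (E k))%E.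
  have cvE := nondecreasing_cvg_mu (mu := lam) mE.
  rewrite UE in cvE; have {}cvE := cvE (measurable_box (fun=> measurable_itv _)) ndE.
  apply: contrapT => /forallNP hE.
  have : (lam (cube (- L) L) <= (V / 2)%:E)%E.
    rewrite -(cvg_lim _ cvE)//; apply: lime_le; first exact: cvgP cvE.
    by apply: nearW => k; rewrite leNgt; apply/negP; exact: hE.
  rewrite lebesgue_cube; last by lra.
  rewrite (_ : (_ - _) ^+ n = V'); first by rewrite lee_fin leNgt VV'.
  by rewrite /V'; congr (_ ^+ n); ring.
exists (k%:R *+ 2) => x c xle xc.
have [y [[_ hy] [_ hyx] ]] : exists y,
    [/\ E k y, E k (y + x) & ~ ~ (h (y + x) - h y = c)].
  apply: (@meets_translate R n (E k) (cube (- (L + 1)) (L + 1))) => //.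
  - exact: measurable_box.
  - move=> y [+ _] i => /(_ i); rewrite /= !in_itv/= => /andP[]; lra.
  - move=> y [+ _] i => /(_ i); rewrite /= !in_itv/= mxE.
    by have := xle i; rewrite ler_norml => /andP[] ? ? /andP[]; lra.
  - rewrite lebesgue_cube; last by lra.
    rewrite (_ : (_ - _) ^+ n = V / 2 + V / 2); last first.
      by rewrite -splitr /V; congr (_ ^+ n); ring.
    by rewrite EFinD lteD.
move=> /contrapT <-; rewrite (le_trans (ler_normB _ _))// mulr2n.
exact: lerD.
Qed.

Lemma additive_ae_linear :
  exists a : 'I_n -> R, \forall x \ae lam, h x = \sum_i a i * x i ord0.
Proof.
have [G GP] := choice ae_increment_total.
have GD : {morph G : x y / x + y}.
  by move=> x y; apply: ae_increment_uniq (GP _) (ae_incrementD (GP x) (GP y)).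
have G0 : G 0 = 0 by have := GD 0 0; rewrite addr0; lra.
have [K GK] := ae_increment_bounded.
exists (fun i => G (delta_mx i ord0)).
apply: filterS ae_increment_self => x xhx.
rewrite (ae_increment_uniq xhx (GP x)) [in LHS](matrix_sum_delta x).
rewrite (big_morph G GD G0); apply: eq_bigr => i _.
rewrite big_ord1 mulrC.
have := @additive_bounded_linear R (fun t => G (t *: delta_mx i ord0)) K.
rewrite scale1r; apply; first by move=> s t /=; rewrite scalerDl GD.
move=> t t1; apply: GK (GP _) => j; rewrite !mxE.
by case: (_ && _); rewrite ?mulr1 ?mulr0 ?normr0.
Qed.
End additive_ae.

(** * The almost everywhere Cauchy equation *)

Section cauchy_linear.
Context (R : realType) (n m : nat).
Local Notation lam := (lebesgue_cV R).

Lemma lebesgue_measurable_fun_mod (f g : 'cV[R]_n -> 'cV[R]_m) :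
  measurable_fun setT g -> (\forall x \ae lam n, f x = g x) ->
  lebesgue_measurable_fun f.
Proof.
move=> mg fg B mB; apply: (borel_mod_completed (preimage_measurable mg mB)).
by apply: filterS fg => x /= ->.
Qed.

Lemma borel_representative_cV (f : 'cV[R]_n -> 'cV[R]_m) :
  lebesgue_measurable_fun f ->
  exists2 g, measurable_fun setT g & \forall x \ae lam n, f x = g x.
Proof.
move=> mf.
have /choice[h hP] : forall j, exists h : 'cV[R]_n -> R,
    measurable_fun setT h /\ \forall x \ae lam n, f x j ord0 = h x.
  move=> j; have [|h mh fh] := @borel_representative R n (fun x => f x j ord0).
    move=> B mB; apply: (mf (cV_coord j @^-1` B)).
    exact: preimage_measurable (measurable_cV_coord j) mB.
  by exists h.
exists (fun x => \col_j h j x).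
  apply: measurable_fun_cV => j.
  rewrite (_ : _ \o _ = h j); first by have [] := hP j.
  by apply/funext => x; rewrite /cV_coord/= mxE.
have : \forall x \ae lam n, forall j, f x j ord0 = h j x.
  by apply: filter_forall => j; have [] := hP j.
by apply: filterS => x fx; apply/colP => j; rewrite mxE fx.
Qed.

Lemma cauchy_equation_ae_congr (f g : 'cV[R]_n -> 'cV[R]_m) :
  (\forall x \ae lam n, f x = g x) ->
  (\forall z \ae lam (n + n)%N,
     f (usubmx z + dsubmx z) = f (usubmx z) + f (dsubmx z)) ->
  \forall z \ae lam (n + n)%N,
     g (usubmx z + dsubmx z) = g (usubmx z) + g (dsubmx z).
Proof.
move=> fg fD; have fu := ae_usubmx n fg; have fd := ae_dsubmx n fg.
apply: filterS (filterI (filterI fu fd) (filterI (ae_addsubmx fg) fD)).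
by move=> z /= [[<- <-] [<- ->]].
Qed.

Lemma linear_cauchy (f : 'cV[R]_n -> 'cV[R]_m) :
  linear_ae f -> cauchy_equation_ae f.
Proof.
move=> [A fA]; split.
  by apply: (lebesgue_measurable_fun_mod _ fA); exact: measurable_mulmx.
apply: (@cauchy_equation_ae_congr (fun x => A *m x)).
  by apply: filterS fA => x ->.
by apply: aeW => z; rewrite mulmxDr.
Qed.

Lemma cauchy_linear (f : 'cV[R]_n -> 'cV[R]_m) :
  cauchy_equation_ae f -> linear_ae f.
Proof.
move=> [/borel_representative_cV[g mg fg] /(cauchy_equation_ae_congr fg) gD].
have /choice[a aP] : forall j, exists a : 'I_n -> R,
    \forall x \ae lam n, g x j ord0 = \sum_i a i * x i ord0.
  move=> j; apply: additive_ae_linear; last exact: measurable_cV_entry.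
  by apply: filterS gD => z ->; rewrite mxE.
exists (\matrix_(j, i) a j i).
have : \forall x \ae lam n, forall j, g x j ord0 = \sum_i a j i * x i ord0.
  exact: filter_forall.
move: fg; apply: filterS2 => x -> gx; apply/colP => j.
by rewrite gx mxE; apply: eq_bigr => i _; rewrite mxE.
Qed.

End cauchy_linear.

(** * Measures with a density *)

Section density_measure.
Context d (T : measurableType d) (R : realType).
Variables (mu : {measure set T -> \bar R}) (p : T -> R).
Hypotheses (mp : measurable_fun setT p) (p0 : forall x, 0 <= p x).
Local Open Scope ereal_scope.

Definition density_measure (A : set T) : \bar R := \int[mu]_(x in A) (p x)%:E.

Let density_measure0 : density_measure set0 = 0.
Proof. exact: integral_set0. Qed.

Let density_measure_ge0 A : 0 <= density_measure A.
Proof. by apply: integral_ge0 => x _; rewrite lee_fin. Qed.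

Let density_measure_sigma_additive : semi_sigma_additive density_measure.
Proof.
move=> F mF tF mUF; rewrite /density_measure ge0_integral_bigcup//.
- by apply: is_cvg_ereal_nneg_natsum => k _; exact: density_measure_ge0.
- exact/measurable_EFinP/measurable_funTS.
- by move=> x _; rewrite lee_fin.
Qed.

HB.instance Definition _ := isMeasure.Build _ _ _ density_measure
  density_measure0 density_measure_ge0 density_measure_sigma_additive.

Definition density : {measure set T -> \bar R} := density_measure.

Lemma densityE A : density A = \int[mu]_(x in A) (p x)%:E.
Proof. by []. Qed.

End density_measure.

Section integral_density.
Context d (T : measurableType d) (R : realType).
Variables (mu nu : {measure set T -> \bar R}) (p : T -> R).
Hypotheses (mp : measurable_fun setT p) (p0 : forall x, 0 <= p x).
Hypothesis nuE : forall A, measurable A ->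
  nu A = (\int[mu]_(x in A) (p x)%:E)%E.
Local Open Scope ereal_scope.
Import HBNNSimple.

Lemma ge0_integral_density (f : T -> \bar R) :
  measurable_fun setT f -> (forall x, 0 <= f x) ->
  \int[nu]_x f x = \int[mu]_x (f x * (p x)%:E).
Proof.
move=> mf f0; pose f_ := nnsfun_approx measurableT mf.
have f_cvg x : EFin \o f_^~ x @ \oo --> f x by exact: cvg_nnsfun_approx.
have f_nd x : {homo (fun k => (f_ k x)%:E) : i j / (i <= j)%N >-> i <= j}.
  by move=> i j ij; rewrite lee_fin; exact/lefP/nd_nnsfun_approx.
have mfp k : measurable_fun setT (fun x => (f_ k x * p x)%:E).
  by apply/measurable_EFinP; exact: measurable_funM.
transitivity (limn (fun k => \int[nu]_x (f_ k x)%:E)).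
  rewrite -monotone_convergence//.
  - by apply: eq_integral => x _; apply/esym/cvg_lim => //; exact: f_cvg.
  - by move=> k; exact/measurable_EFinP.
  - by move=> k x _; rewrite lee_fin.
transitivity (limn (fun k => \int[mu]_x (f_ k x * p x)%:E)); last first.
  rewrite -monotone_convergence//.
  - apply: eq_integral => x _; apply/cvg_lim => //=.
    under eq_fun do rewrite EFinM.
    by apply: cvgeZr => //; exact: f_cvg.
  - by move=> k x _; rewrite lee_fin mulr_ge0.
  - move=> x _ i j ij; rewrite lee_fin ler_wpM2r// -lee_fin; exact: f_nd.
congr (limn _); apply/funext => k.
rewrite integralT_nnsfun sintegralE.
transitivity (\sum_(r \in range (f_ k))
    \int[mu]_x (r * (\1_(f_ k @^-1` [set r]) x * p x))%:E); last first.
  rewrite -ge0_integral_fsum//.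
  - apply: eq_integral => x _; rewrite fsumEFin//; congr (_%:E).
    rewrite [in RHS]fimfunE mulr_fsuml//.
    by apply: eq_fsbigr => r _; rewrite mulrA.
  - move=> r; apply/measurable_EFinP; apply: measurable_funM => //.
    exact: measurable_funM.
  - move=> r x _; rewrite lee_fin indicE; have [xr|xr] := boolP (x \in _).
      by move: xr; rewrite inE/= => <-; rewrite mul1r mulr_ge0.
    by rewrite mul0r mulr0.
apply: eq_fsbigr => r /[!inE] -[x _ fx].
under eq_integral do rewrite EFinM.
rewrite ge0_integralZl_EFin//.
- rewrite nuE//; congr (_ * _); rewrite integral_mkcond.
  apply: eq_integral => y _; rewrite patchE indicE.
  by case: ifP => _; rewrite ?mul1r ?mul0r.
- by move=> y _; rewrite lee_fin mulr_ge0.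
- by apply/measurable_EFinP; exact: measurable_funM.
- by rewrite -fx.
Qed.

Lemma integrable_density (f : T -> R) : measurable_fun setT f ->
  nu.-integrable setT (EFin \o f) <->
  mu.-integrable setT (fun x => (f x * p x)%:E).
Proof.
move=> mf; have E : \int[nu]_x `|(f x)%:E| = \int[mu]_x `|(f x * p x)%:E|.
  rewrite ge0_integral_density//; last first.
    by apply: measurableT_comp => //; exact/measurable_EFinP.
  by apply: eq_integral => x _; rewrite /= normrM (ger0_norm (p0 x)).
split=> /integrableP[_ fi]; apply/integrableP; split.
- by apply/measurable_EFinP; exact: measurable_funM.
- by rewrite -E.
- exact/measurable_EFinP.
- by rewrite E.
Qed.

Lemma integral_density (f : T -> R) : measurable_fun setT f ->
  \int[nu]_x (f x)%:E = \int[mu]_x (f x * p x)%:E.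
Proof.
move=> mf; have mEf : measurable_fun setT (EFin \o f) by exact/measurable_EFinP.
rewrite integralE [RHS]integralE.
rewrite (ge0_integral_density (measurable_funepos mEf))//.
rewrite (ge0_integral_density (measurable_funeneg mEf))//.
have p0E x : 0 <= (p x)%:E by rewrite lee_fin.
congr (_ - _); apply: eq_integral => x _.
- by rewrite !funeposE -!EFin_max -EFinM maxr_pMl// mul0r.
- by rewrite !funenegE -!EFin_max -EFinM maxr_pMl// mul0r mulNr.
Qed.

End integral_density.

(** * Gaussian densities *)

(** Tonelli's theorem, one coordinate at a time. *)
Lemma integral_lebesgue_cV_prod (R : realType) (n : nat)
    (phi : 'I_n -> R -> R) :
  (forall i, measurable_fun setT (phi i)) -> (forall i x, 0 <= phi i x) ->
  (\int[lebesgue_cV R n]_x (\prod_i phi i (x i ord0))%:E =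
   \prod_i \int[lebesgue_measure]_t (phi i t)%:E)%E.
Proof.
elim: n phi => [|n IH] phi mphi phi0.
  rewrite big_ord0; under eq_integral do rewrite big_ord0.
  by rewrite integral_dirac//= diracT mul1e.
have mprod k (psi : 'I_k -> R -> R) : (forall i, measurable_fun setT (psi i)) ->
    measurable_fun setT (fun x : 'cV[R]_k => \prod_i psi i (x i ord0)).
  move=> mpsi; apply: measurable_prod => i _.
  by apply: measurableT_comp => //; exact: measurable_cV_entry.
have prod0 k (psi : 'I_k -> R -> R) : (forall i x, 0 <= psi i x) ->
    forall x : 'cV[R]_k, 0 <= \prod_i psi i (x i ord0).
  by move=> psi0 x; exact: prodr_ge0.
pose F (x : 'cV[R]_n.+1) := (\prod_i phi i (x i ord0))%:E.
have mF : measurable_fun setT F by apply/measurable_EFinP; exact: mprod.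
have F0 x : (0 <= F x)%E by rewrite lee_fin prod0.
rewrite [LHS](_ : _ = (\int[pushforward (lebesgue_measure \x lebesgue_cV R n)%E
    (@cV_cons R n)]_x F x)%E)//.
rewrite ge0_integral_pushforward//; last exact: measurable_cV_cons.
rewrite preimage_setT fubini_tonelli1//; last 2 first.
- exact: measurableT_comp mF (@measurable_cV_cons R n).
- by move=> z; exact: F0.
rewrite big_ord_recl -IH// -ge0_integralZr//.
- apply: eq_integral => a _; rewrite /fubini_F -ge0_integralZl//.
  + apply: eq_integral => v _; rewrite /F/= big_ord_recl EFinM.
    congr (_%:E * _%:E)%E.
      by congr (phi _ _); exact: (congr1 fst (cV_consK (a, v))).
    apply: eq_bigr => i _; congr (phi _ _).
    rewrite (_ : lift ord0 i = rshift 1 i); last exact: val_inj.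
    by rewrite /cV_cons (col_mxEd a%:M v).
  + apply/measurable_EFinP.
    by apply: (mprod n (fun i => phi (lift ord0 i))) => i; exact: mphi.
  + move=> v _; rewrite lee_fin.
    by apply: (prod0 n (fun i => phi (lift ord0 i))) => i t; exact: phi0.
  + by rewrite lee_fin.
- by apply/measurable_EFinP; exact: mphi.
- by move=> a _; rewrite lee_fin.
- apply: integral_ge0 => v _; rewrite lee_fin.
  by apply: (prod0 n (fun i => phi (lift ord0 i))) => i t; exact: phi0.
Qed.

Section gauss_pdf.
Context (R : realType) (n : nat).
Local Notation lam := (lebesgue_cV R n).
Implicit Types (u : R) (x y z : 'cV[R]_n).

Definition dot x y : R := \sum_i x i ord0 * y i ord0.

Lemma dotDl x y z : dot (x + y) z = dot x z + dot y z.
Proof. by rewrite /dot -big_split/=; apply: eq_bigr => i _; rewrite mxE mulrDl. Qed.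

Lemma dotC x y : dot x y = dot y x.
Proof. by apply: eq_bigr => i _; rewrite mulrC. Qed.

Lemma dotDr x y z : dot z (x + y) = dot z x + dot z y.
Proof. by rewrite dotC dotDl !(dotC z). Qed.

Lemma dotNl x y : dot (- x) y = - dot x y.
Proof. by rewrite /dot -sumrN; apply: eq_bigr => i _; rewrite mxE mulNr. Qed.

Lemma dotNr x y : dot x (- y) = - dot x y.
Proof. by rewrite dotC dotNl dotC. Qed.

Lemma dot0l x : dot 0 x = 0.
Proof. by rewrite /dot big1// => i _; rewrite mxE mul0r. Qed.

Lemma dotZl (c : R) x y : dot (c *: x) y = c * dot x y.
Proof. by rewrite /dot mulr_sumr; apply: eq_bigr => i _; rewrite mxE mulrA. Qed.

Lemma dotZr (c : R) x y : dot x (c *: y) = c * dot x y.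
Proof. by rewrite dotC dotZl dotC. Qed.

Lemma measurable_dot d (T : measurableType d) (f g : T -> 'cV[R]_n) :
  measurable_fun setT f -> measurable_fun setT g ->
  measurable_fun setT (fun t : T => dot (f t) (g t)).
Proof.
move=> mf mg; apply: measurable_sum => i.
by apply: measurable_funM; exact: measurable_cV_entry.
Qed.

Definition gauss_pdf u x : R := \prod_i normal_pdf 0 (Num.sqrt u) (x i ord0).

Lemma measurable_gauss_pdf u : measurable_fun setT (gauss_pdf u).
Proof.
apply: measurable_prod => i _; apply: measurableT_comp.
  exact: measurable_normal_pdf.
exact: measurable_cV_entry.
Qed.

Lemma gauss_pdf_ge0 u x : 0 <= gauss_pdf u x.
Proof. by apply: prodr_ge0 => i _; exact: normal_pdf_ge0. Qed.

Lemma gauss_pdfE u x : 0 < u ->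
  gauss_pdf u x = normal_peak (Num.sqrt u) ^+ n * expR (- dot x x / (u *+ 2)).
Proof.
move=> u0; have su0 : Num.sqrt u != 0 by rewrite gt_eqF// sqrtr_gt0.
rewrite /gauss_pdf normal_pdfE// big_split/= prodr_const card_ord; congr (_ * _).
rewrite -expR_sum; congr expR; rewrite -mulr_suml -sumrN; congr (_ * _).
  by apply: eq_bigr => i _; rewrite subr0 expr2.
by rewrite sqr_sqrtr// ltW.
Qed.

Lemma gauss_pdf_gt0 u x : 0 < u -> 0 < gauss_pdf u x.
Proof.
move=> u0; rewrite gauss_pdfE// mulr_gt0 ?expR_gt0// exprn_gt0//.
by rewrite normal_peak_gt0// gt_eqF// sqrtr_gt0.
Qed.

(** Completing the square. *)
Lemma gauss_pdf_shiftM u a b z : 0 < u ->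
  gauss_pdf u (z - a) * gauss_pdf u (z - b) =
  gauss_pdf u z * (expR (dot a b / u) * gauss_pdf u (z - (a + b))).
Proof.
move=> u0; rewrite !gauss_pdfE// mulrACA [RHS](_ : _ =
  (normal_peak (Num.sqrt u) ^+ n * normal_peak (Num.sqrt u) ^+ n) *
  (expR (- dot z z / (u *+ 2)) * (expR (dot a b / u) *
   expR (- dot (z - (a + b)) (z - (a + b)) / (u *+ 2))))); last by ring.
congr (_ * _); rewrite -!expRD; congr expR.
rewrite !opprD !dotDl !dotDr !dotNl !dotNr (dotC a z) (dotC b z) (dotC b a).
by field; rewrite gt_eqF.
Qed.

Lemma integral_gauss_pdf_box u (B : 'I_n -> set R) :
  (forall i, measurable (B i)) ->
  (\int[lam]_(x in box B) (gauss_pdf u x)%:E =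
   \prod_i normal_prob 0 (Num.sqrt u) (B i))%E.
Proof.
move=> mB; transitivity (\int[lam]_x (\prod_i
    (\1_(B i) (x i ord0) * normal_pdf 0 (Num.sqrt u) (x i ord0)))%:E)%E.
  rewrite integral_mkcond; apply: eq_integral => x _; rewrite patchE.
  case: ifPn => [xB|/negP xB]; congr (_%:E).
    apply: eq_bigr => i _; rewrite indicE mem_set ?mul1r//.
    by move: xB; rewrite inE.
  apply/esym/eqP; rewrite prodf_seq_eq0; apply/hasP.
  have [i xi] : exists i, ~ B i (x i ord0).
    by apply/existsNP => h; apply: xB; rewrite inE.
  exists i => /=; first exact: mem_index_enum.
  by rewrite indicE memNset// mul0r.
rewrite (integral_lebesgue_cV_prod
  (phi := fun i t => \1_(B i) t * normal_pdf 0 (Num.sqrt u) t)).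
- apply: eq_bigr => i _; rewrite /normal_prob [RHS]integral_mkcond.
  apply: eq_integral => t _; rewrite patchE indicE.
  by case: ifP => _; rewrite ?mul1r ?mul0r.
- by move=> i; apply: measurable_funM => //; exact: measurable_normal_pdf.
- by move=> i t; rewrite mulr_ge0 ?normal_pdf_ge0.
Qed.

Lemma integral_gauss_pdf u : (\int[lam]_x (gauss_pdf u x)%:E = 1)%E.
Proof.
have := @integral_gauss_pdf_box u (fun=> setT) (fun=> measurableT).
by rewrite boxT => ->; rewrite big1// => i _; exact: probability_setT.
Qed.

Lemma integrable_gauss_pdf u : lam.-integrable setT (EFin \o gauss_pdf u).
Proof.
apply/integrableP; split; first by apply/measurable_EFinP; exact: measurable_gauss_pdf.
rewrite (_ : (\int[lam]_x _)%E = 1%E) ?ltry// -(integral_gauss_pdf u).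
by apply: eq_integral => x _; rewrite /= ger0_norm ?gauss_pdf_ge0.
Qed.

End gauss_pdf.

(** * Functions invariant under the heat semigroup *)

(** Since exp t - 1 <= t exp t, the remainder is at most t (exp t - 1). *)
Lemma expR_taylor1_le (R : realType) (t : R) :
  `|expR t - 1 - t| <= t ^+ 2 * expR `|t|.
Proof.
have e1 (s : R) : 1 + s <= expR s by exact: expR_ge1Dx.
have em1 : expR t - 1 <= t * expR t.
  have := e1 (- t); rewrite expRN -(ler_pM2r (expR_gt0 t)) mulVf ?gt_eqF ?expR_gt0//.
  lra.
rewrite ger0_norm; last by have := e1 t; lra.
have [t0|t0] := leP 0 t.
  have : t * (expR t - 1) <= t * (t * expR t) by rewrite ler_wpM2l.
  rewrite ger0_norm//; lra.
have ab1 : 1 <= expR `|t| by rewrite (le_trans _ (e1 _))// lerDl.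
have t21 : t ^+ 2 <= t ^+ 2 * expR `|t| by rewrite ler_peMr// sqr_ge0.
apply: le_trans t21; have := e1 t.
have : 0 <= - t * (expR t - 1 - t) by rewrite mulr_ge0//; have := e1 t; lra.
lra.
Qed.

Section gauss_increment.
Context (R : realType) (n : nat).
Local Notation lam := (lebesgue_cV R n).
Local Notation p := (@gauss_pdf R n).

Lemma measurable_gauss_pdfB u (a : 'cV[R]_n) :
  measurable_fun setT (fun z : 'cV[R]_n => p u (z - a)).
Proof.
apply: measurableT_comp; first exact: measurable_gauss_pdf.
exact: measurable_cVD.
Qed.

Lemma integral_gauss_pdfB u (a : 'cV[R]_n) :
  (\int[lam]_z (p u (z - a))%:E = 1)%E.
Proof.
rewrite -(integral_gauss_pdf n u).
apply: (integral_translation (- a) (f := EFin \o p u)).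
by apply/measurable_EFinP; exact: measurable_gauss_pdf.
Qed.

Lemma integrable_gauss_pdfB u (a : 'cV[R]_n) :
  lam.-integrable setT (fun z : 'cV[R]_n => (p u (z - a))%:E).
Proof. exact: integrable_translation (integrable_gauss_pdf n u). Qed.

Context (I : finType) (s : I -> R) (a : I -> 'cV[R]_n).

(** For g invariant under the heat semigroup and almost all centres a i, the
    integral of g against such a combination is sum_i s i * g (a i), whatever the
    variance u. *)
Definition gauss_comb u (z : 'cV[R]_n) : R := \sum_i s i * p u (z - a i).

Lemma measurable_gauss_comb u : measurable_fun setT (gauss_comb u).
Proof.
apply: measurable_sum => i; apply: measurable_funM => //.
exact: measurable_gauss_pdfB.
Qed.

Lemma gauss_comb_sqr u z : 0 < u -> gauss_comb u z ^+ 2 / p u z =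
  \sum_i \sum_j s i * s j * expR (dot (a i) (a j) / u) * p u (z - (a i + a j)).
Proof.
move=> u0; rewrite expr2 mulr_suml mulr_suml; apply: eq_bigr => i _.
rewrite mulr_sumr mulr_suml; apply: eq_bigr => j _.
rewrite mulrACA gauss_pdf_shiftM//; field.
by rewrite gt_eqF ?gauss_pdf_gt0.
Qed.

Lemma measurable_gauss_comb_sqr u : 0 < u ->
  measurable_fun setT (fun z => gauss_comb u z ^+ 2 / p u z).
Proof.
move=> u0; under eq_fun do rewrite gauss_comb_sqr//.
apply: measurable_sum => i; apply: measurable_sum => j.
by apply: measurable_funM => //; exact: measurable_gauss_pdfB.
Qed.

Lemma integral_gauss_comb_sqr u : 0 < u ->
  (\int[lam]_z (gauss_comb u z ^+ 2 / p u z)%:E =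
   (\sum_i \sum_j s i * s j * expR (dot (a i) (a j) / u))%:E)%E.
Proof.
move=> u0; under eq_integral do rewrite gauss_comb_sqr// -sumEFin.
have ic (c : R) b : lam.-integrable setT (fun z : 'cV[R]_n => (c * p u (z - b))%:E).
  under eq_fun do rewrite EFinM.
  by apply: integrableZl => //; exact: integrable_gauss_pdfB.
rewrite integral_sum//; last first.
  move=> i; under eq_fun do rewrite -sumEFin.
  by apply: integrable_sum => // j _; exact: ic.
rewrite -sumEFin; apply: eq_bigr => i _.
under eq_integral do rewrite -sumEFin.
rewrite integral_sum//.
rewrite -sumEFin; apply: eq_bigr => j _.
under eq_integral do rewrite EFinM.
rewrite integralZl//; last exact: integrable_gauss_pdfB.
by rewrite integral_gauss_pdfB mule1.
Qed.

(** The chi-square distance is of second order in 1/u: the vanishing of the total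
    weight and of the barycentre kill the terms of order 0 and 1. *)
Lemma integral_gauss_comb_sqr_le :
  \sum_i s i = 0 -> \sum_i s i *: a i = 0 ->
  exists2 K : R, 0 <= K & forall u, 1 <= u ->
    (\int[lam]_z (gauss_comb u z ^+ 2 / p u z)%:E <= (K / u ^+ 2)%:E)%E.
Proof.
move=> s0 sa0.
pose c i j := dot (a i) (a j).
exists (\sum_i \sum_j `|s i * s j| * (c i j ^+ 2 * expR `|c i j|)).
  by do 2!(apply: sumr_ge0 => ? _); rewrite mulr_ge0// mulr_ge0 ?sqr_ge0 ?expR_ge0.
move=> u u1; have u0 : 0 < u by lra.
rewrite integral_gauss_comb_sqr// lee_fin.
have -> : \sum_i \sum_j s i * s j * expR (c i j / u) =
    \sum_i \sum_j s i * s j * (expR (c i j / u) - 1 - c i j / u).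
  have E1 : \sum_i \sum_j s i * s j = 0.
    by under eq_bigr do rewrite -mulr_sumr s0 mulr0; rewrite big1.
  have E2 : \sum_i \sum_j s i * s j * (c i j / u) = 0.
    rewrite big1// => i _.
    have -> : \sum_j s i * s j * (c i j / u) = s i / u * dot (a i) (\sum_j s j *: a j).
      have dotD : {morph dot (a i) : x y / x + y} by move=> x y; rewrite dotDr.
      have dot0 : dot (a i) 0 = 0 by rewrite dotC dot0l.
      rewrite (big_morph _ dotD dot0) mulr_sumr; apply: eq_bigr => j _.
      by rewrite dotZr /c; ring.
    by rewrite sa0 dotC dot0l mulr0.
  transitivity (\sum_i \sum_j s i * s j * expR (c i j / u) -
      \sum_i \sum_j s i * s j - \sum_i \sum_j s i * s j * (c i j / u)).
    by rewrite E1 E2 !subr0.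
  rewrite -!sumrB.
  apply: eq_bigr => i _; rewrite -!sumrB; apply: eq_bigr => j _; ring.
rewrite mulr_suml; apply: ler_sum => i _; rewrite mulr_suml; apply: ler_sum => j _.
apply: (le_trans (ler_norm _)); rewrite normrM -mulrA ler_wpM2l//.
apply: (le_trans (expR_taylor1_le _)).
rewrite expr_div_n mulrAC ler_wpM2r ?invr_ge0 ?sqr_ge0// ler_wpM2l ?sqr_ge0//.
by rewrite ler_expR normrM ler_piMr// normfV (ger0_norm (ltW u0)) invf_le1.
Qed.

End gauss_increment.

Section heat_additive.
Context (R : realType) (n : nat) (g : 'cV[R]_n -> R) (C : R).
Local Notation lam := (lebesgue_cV R n).
Local Notation p := (@gauss_pdf R n).
Hypothesis mg : measurable_fun setT g.
Hypothesis g2 : forall k : nat,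
  (\int[lam]_z (g z ^+ 2 * p k.+1%:R z)%:E <= (C * k.+1%:R)%:E)%E.

(** Young's inequality with weight alpha, where g is weighted by the square root
    of p and the combination by its inverse. *)
Lemma integral_mul_gauss_comb_le (I : finType) (s : I -> R) (a : I -> 'cV[R]_n)
    (k : nat) (alpha : R) : 0 < alpha ->
  (\int[lam]_z `|(g z * gauss_comb s a k.+1%:R z)%:E| <=
   (alpha * (C * k.+1%:R))%:E +
   alpha^-1%:E * \int[lam]_z (gauss_comb s a k.+1%:R z ^+ 2 / p k.+1%:R z)%:E)%E.
Proof.
move=> a0; set u : R := k.+1%:R.
have u0 : 0 < u by rewrite ltr0n.
have mq := measurable_gauss_comb s a u.
have mq2 := measurable_gauss_comb_sqr s a u0.
set q := gauss_comb s a u in mq mq2 *.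
have mpu : measurable_fun setT (p u) by exact: measurable_gauss_pdf.
have p0 z : 0 < p u z by exact: gauss_pdf_gt0.
have q2p0 z : 0 <= q z ^+ 2 / p u z by rewrite divr_ge0 ?sqr_ge0 ?ltW.
have g2p0 z : 0 <= g z ^+ 2 * p u z by rewrite mulr_ge0 ?sqr_ge0 ?ltW.
have mg2 : measurable_fun setT (fun z => g z ^+ 2 * p u z).
  by apply: measurable_funM => //; exact: measurable_funX.
apply: (@le_trans _ _ (\int[lam]_z (alpha%:E * (g z ^+ 2 * p u z)%:E +
    alpha^-1%:E * (q z ^+ 2 / p u z)%:E)%E)%E).
  apply: ge0_le_integral => //.
  - apply: measurableT_comp => //; apply/measurable_EFinP; exact: measurable_funM.
  - apply: emeasurable_funD; apply: emeasurable_funM => //; exact/measurable_EFinP.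
  - move=> z _; rewrite -!EFinM -EFinD lee_fin normrM.
    have cp : 0 < alpha * p u z by rewrite mulr_gt0.
    rewrite -(ler_pM2r cp) -[g z ^+ 2]real_normK ?num_real//.
    rewrite -[q z ^+ 2]real_normK ?num_real//.
    set x := `|g z|; set y := `|q z|.
    have -> : (alpha * (x ^+ 2 * p u z) + alpha^-1 * (y ^+ 2 / p u z)) *
        (alpha * p u z) = (alpha * p u z * x) ^+ 2 + y ^+ 2.
      by field; rewrite !gt_eqF.
    have := sqr_ge0 (alpha * p u z * x - y / 2); have := sqr_ge0 y; nra.
rewrite ge0_integralD//; last 4 first.
- by move=> z _; apply: mule_ge0; rewrite lee_fin// ltW.
- by apply: emeasurable_funM => //; exact/measurable_EFinP.
- by move=> z _; apply: mule_ge0; rewrite lee_fin// invr_ge0 ltW.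
- by apply: emeasurable_funM => //; exact/measurable_EFinP.
rewrite ge0_integralZl_EFin//; last 3 first.
- by move=> z _; rewrite lee_fin.
- exact/measurable_EFinP.
- exact: ltW.
rewrite ge0_integralZl_EFin//; last 3 first.
- by move=> z _; rewrite lee_fin.
- exact/measurable_EFinP.
- by rewrite invr_ge0 ltW.
rewrite leeD2r// EFinM lee_wpmul2l ?lee_fin ?(ltW a0)//; exact: g2.
Qed.

Lemma integrable_mul_gauss_comb (I : finType) (s : I -> R) (a : I -> 'cV[R]_n) k :
  lam.-integrable setT (fun z => (g z * gauss_comb s a k.+1%:R z)%:E).
Proof.
apply/integrableP; split.
  by apply/measurable_EFinP; apply: measurable_funM => //; exact: measurable_gauss_comb.
apply: le_lt_trans (integral_mul_gauss_comb_le s a k ltr01) _.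
by rewrite integral_gauss_comb_sqr ?ltr0n// -EFinM -EFinD ltry.
Qed.

(** The two factors have squared norms O(u) and O(1/u^2), with u = k + 1; the
    weight alpha = delta / u splits their product into delta C and O(1/u). *)
Lemma integral_mul_gauss_comb_small (I : finType) (s : I -> R) (a : I -> 'cV[R]_n) :
  \sum_i s i = 0 -> \sum_i s i *: a i = 0 ->
  exists K : R, forall (k : nat) (delta : R), 0 < delta ->
    (`|\int[lam]_z (g z * gauss_comb s a k.+1%:R z)%:E| <=
     (delta * C + K / (delta * k.+1%:R))%:E)%E.
Proof.
move=> s0 sa0; have [K K0 HK] := integral_gauss_comb_sqr_le s0 sa0.
exists K => k delta d0; set u : R := k.+1%:R.
have u0 : 0 < u by rewrite ltr0n.
have mgq : measurable_fun setT (fun z => (g z * gauss_comb s a u z)%:E).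
  by apply/measurable_EFinP; apply: measurable_funM => //; exact: measurable_gauss_comb.
apply: (le_trans (le_abse_integral _ _ mgq)) => //.
have a0 : 0 < delta / u by rewrite divr_gt0.
apply: (le_trans (integral_mul_gauss_comb_le s a k a0)).
rewrite EFinD; apply: leeD.
  by rewrite lee_fin -/u (_ : delta / u * (C * u) = delta * C)//; field; rewrite gt_eqF.
apply: (@le_trans _ _ ((delta / u)^-1%:E * (K / u ^+ 2)%:E)%E).
  by rewrite lee_wpmul2l ?lee_fin ?invr_ge0 ?(ltW a0)// HK// ler1n.
rewrite -EFinM lee_fin le_eqVlt; apply/orP; left; apply/eqP.
by field; rewrite !gt_eqF.
Qed.

Hypothesis g0 : forall k : nat, (\int[lam]_z (g z * p k.+1%:R z)%:E = 0)%E.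
Hypothesis gP : forall k : nat, \forall x \ae lam,
  ((g x)%:E = \int[lam]_z (g z * p k.+1%:R (z - x))%:E)%E.

(** g (x + y) - g x - g y is the integral of g against the mixed second increment
    of a Gaussian density of variance u, for every u, and tends to 0 as u grows. *)
Lemma heat_additive : \forall z \ae lebesgue_cV R (n + n),
  g (usubmx z + dsubmx z) = g (usubmx z) + g (dsubmx z).
Proof.
suff additive x y : (forall k : nat,
      (g x)%:E = \int[lam]_z (g z * p k.+1%:R (z - x))%:E)%E ->
    (forall k : nat, (g y)%:E = \int[lam]_z (g z * p k.+1%:R (z - y))%:E)%E ->
    (forall k : nat,
      (g (x + y)%R)%:E = \int[lam]_z (g z * p k.+1%:R (z - (x + y)))%:E)%E ->
    g (x + y) = g x + g y.
  have gP' := ae_foralln gP.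
  have gu := ae_usubmx n gP'; have gd := ae_dsubmx n gP'.
  apply: filterS (filterI (ae_addsubmx gP') (filterI gu gd)) => z [gz [gzu gzd]].
  exact: (additive _ _ gzu gzd gz).
move=> gx gy gxy.
(* the last term, centred at 0, contributes the mean of g, which vanishes *)
pose s (i : 'I_4) : R := nth 0 [:: 1; -1; -1; 1] i.
pose a (i : 'I_4) : 'cV[R]_n := nth 0 [:: x + y; x; y; 0] i.
have [||K HK] := @integral_mul_gauss_comb_small _ s a.
- by rewrite !big_ord_recl big_ord0 /s/=; ring.
- rewrite !big_ord_recl big_ord0 /s /a/= !scale1r !scaleN1r; apply/colP => i.
  by rewrite !mxE; ring.
have ic b k : lam.-integrable setT (fun z => (g z * p k.+1%:R (z - b))%:E).
  have := integrable_mul_gauss_comb (fun _ : 'I_1 => 1) (fun=> b) k.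
  by under eq_fun do rewrite /gauss_comb big_ord1 mul1r.
pose D := g (x + y) - g x - g y.
have DE k : (D%:E = \int[lam]_z (g z * gauss_comb s a k.+1%:R z)%:E)%E.
  transitivity (\int[lam]_z ((g z * p k.+1%:R (z - (x + y)))%:E -
     (g z * p k.+1%:R (z - x))%:E - (g z * p k.+1%:R (z - y))%:E +
     (g z * p k.+1%:R (z - 0))%:E))%E.
    rewrite integralD//; last first.
      by apply: integrableB => //; apply: integrableB.
    rewrite integralB//; last by apply: integrableB.
    rewrite integralB// -gxy -gx -gy.
    under [X in (_ + X)%E]eq_integral do rewrite subr0.
    by rewrite g0 adde0.
  apply: eq_integral => t _; rewrite -!EFinB -EFinD; congr (_%:E).
  by rewrite /gauss_comb !big_ord_recl big_ord0 /s /a/=; ring.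
apply/eqP; rewrite -subr_eq0 opprD addrA -/D; apply: contrapT => /negP D0.
have {}D0 : 0 < `|D| by rewrite normr_gt0.
(* delta makes the first term at most |D| / 4, and then k does the same for the
   second *)
pose delta := `|D| / (4 * (`|C| + 1)).
have C1 : 0 < `|C| + 1 by rewrite ltr_wpDl.
have d0 : 0 < delta by rewrite divr_gt0// mulr_gt0.
pose k := Num.bound (`|K| / delta / (`|D| / 4)).
have : `|K| / delta / (`|D| / 4) < k.+1%:R.
  apply: (@lt_trans _ _ k%:R); last by rewrite ltr_nat.
  by apply: archi_boundP; rewrite !divr_ge0// ltW// divr_gt0.
rewrite ltr_pdivrMr ?divr_gt0// => Kk.
have := HK k delta d0; rewrite -DE lee_fin => DK.
have h1 : delta * C <= `|D| / 4.
  apply: (@le_trans _ _ (delta * (`|C| + 1))).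
    by rewrite ler_wpM2l ?(ltW d0)// (le_trans (ler_norm C))// lerDl.
  by rewrite /delta le_eqVlt; apply/orP; left; apply/eqP; field; rewrite gt_eqF.
have h2 : K / (delta * k.+1%:R) <= `|D| / 4.
  rewrite invfM mulrA ler_pdivrMr ?ltr0n// [leRHS]mulrC.
  apply: le_trans (ltW Kk); rewrite ler_wpM2r ?invr_ge0 ?(ltW d0)//.
  exact: ler_norm.
by have := le_trans DK (lerD h1 h2); move: `|D| D0 => D1 D10; lra.
Qed.

End heat_additive.

(** * Independence and joint laws *)

Section joint_law.
Context d d1 d2 (Omega : measurableType d) (T1 : measurableType d1)
  (T2 : measurableType d2) (R : realType) (P : probability Omega R).
Variables (X : {mfun Omega >-> T1}) (Z : {mfun Omega >-> T2}).
Hypothesis XZ : forall A B, measurable A -> measurable B ->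
  P (X @^-1` A `&` Z @^-1` B) = (P (X @^-1` A) * P (Z @^-1` B))%E.
Local Open Scope ereal_scope.
Local Notation prod := (distribution P X \x distribution P Z).

Let mXZ : measurable_fun setT (fun w => (X w, Z w)).
Proof. exact: measurable_fun_pair. Qed.

Lemma joint_law C : measurable C -> prod C = P [set w | C (X w, Z w)].
Proof.
move=> mC; rewrite (product_measure_unique (m' := image_measure P mXZ))//.
Qed.

Lemma ge0_integral_joint_law f D : measurable D ->
  measurable_fun setT f -> (forall z, 0 <= f z) ->
  \int[prod]_(z in D) f z = \int[P]_(w in [set w | D (X w, Z w)]) f (X w, Z w).
Proof.
move=> mD mf f0.
transitivity (\int[pushforward P (fun w => (X w, Z w))]_(z in D) f z).
  apply: eq_measure_integral => C mC _.
  exact: joint_law.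
rewrite ge0_integral_pushforward//; exact: measurable_funTS.
Qed.

Lemma integrable_joint_law f : measurable_fun setT f ->
  prod.-integrable setT f <-> P.-integrable setT (fun w => f (X w, Z w)).
Proof.
move=> mf.
have E : \int[prod]_z `|f z| = \int[P]_w `|f (X w, Z w)|.
  by rewrite ge0_integral_joint_law//; exact: measurableT_comp.
split=> /integrableP[_ fi]; apply/integrableP; split => //.
- exact: measurableT_comp mf mXZ.
- by rewrite -E.
- by rewrite E.
Qed.

Lemma integral_joint_law f D : measurable D -> measurable_fun setT f ->
  \int[prod]_(z in D) f z = \int[P]_(w in [set w | D (X w, Z w)]) f (X w, Z w).
Proof.
move=> mD mf; rewrite integralE [RHS]integralE; congr (_ - _).
- rewrite ge0_integral_joint_law//; last exact: measurable_funepos.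
  by apply: eq_integral => w _; rewrite !funeposE.
- rewrite ge0_integral_joint_law//; last exact: measurable_funeneg.
  by apply: eq_integral => w _; rewrite !funenegE.
Qed.

Section product.
Variables (u : T1 -> R) (v : T2 -> R).
Hypotheses (mu : measurable_fun setT u) (mv : measurable_fun setT v).
Hypotheses (iu : P.-integrable setT (fun w => (u (X w))%:E))
  (iv : P.-integrable setT (fun w => (v (Z w))%:E)).

Let muv : measurable_fun setT (fun z : T1 * T2 => (u z.1 * v z.2)%:E).
Proof.
by apply/measurable_EFinP; apply: measurable_funM; exact: measurableT_comp.
Qed.

Let iuX : (distribution P X).-integrable setT (EFin \o u).
Proof. by apply: integrable_pushforward => //; exact/measurable_EFinP. Qed.

Let ivZ : (distribution P Z).-integrable setT (EFin \o v).
Proof. by apply: integrable_pushforward => //; exact/measurable_EFinP. Qed.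

Let iuv : prod.-integrable setT (fun z => (u z.1 * v z.2)%:E).
Proof.
apply/integrable12ltyP => //=.
under eq_integral => x _.
  under eq_integral do rewrite normrM EFinM.
  rewrite ge0_integralZl//; last first.
    by apply/measurable_EFinP; exact: measurableT_comp.
  over.
rewrite ge0_integralZr//.
- apply: lte_mul_pinfty.
  + by apply: integral_ge0.
  + by have /integrableP[_] := iuX; rewrite ge0_fin_numE ?integral_ge0.
  + by have /integrableP[_] := ivZ.
- by apply/measurable_EFinP; exact: measurableT_comp.
- by apply: integral_ge0.
Qed.

Lemma integrable_mul_indep : P.-integrable setT (fun w => (u (X w) * v (Z w))%:E).
Proof. exact/(integrable_joint_law muv). Qed.

Lemma integral_mul_indep :
  \int[P]_w (u (X w) * v (Z w))%:E =
  \int[P]_w (u (X w))%:E * \int[P]_w (v (Z w))%:E.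
Proof.
rewrite -(integral_joint_law measurableT muv) -integral12_prod_meas1//.
have EX : \int[distribution P X]_x (u x)%:E = \int[P]_w (u (X w))%:E.
  by rewrite integral_distribution//; exact/measurable_EFinP.
have EZ : \int[distribution P Z]_x (v x)%:E = \int[P]_w (v (Z w))%:E.
  by rewrite integral_distribution//; exact/measurable_EFinP.
rewrite /fubini_F/=; under eq_integral => x _.
  under eq_integral do rewrite EFinM.
  rewrite integralZl//.
  over.
rewrite -EZ -EX; have : \int[distribution P Z]_x (v x)%:E \is a fin_num.
  exact: integrable_fin_num.
move=> /fineK <-; rewrite integralZr//.
Qed.

End product.
End joint_law.

Lemma eq_measure_ae d (T : measurableType d) (R : realType)
    (mu : {measure set T -> \bar R}) (A B : set T) :
  measurable A -> measurable B -> (\forall x \ae mu, A x <-> B x) ->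
  mu A = mu B.
Proof.
move=> mA mB AB.
suff le (C D : set T) : measurable C -> measurable D ->
    (\forall x \ae mu, C x <-> D x) -> (mu C <= mu D)%E.
  apply/eqP; rewrite eq_le !le//; apply: filterS AB => x; tauto.
move=> mC mD [N [mN N0 CD]].
rewrite -(measureU0 mD mN N0); apply: le_measure; rewrite ?inE//.
  exact: measurableU.
move=> x Cx; have [Nx|Nx] := pselect (N x); [by right|left].
have : C x <-> D x by apply: contrapT => h; apply: Nx; exact: CD.
by move=> [+ _]; apply.
Qed.

(** * The Brownian filtration *)

Section brownian_filtration.
Context (R : realType) d (Omega : measurableType d) (P : probability Omega R)
  (n : nat) (W : R -> Omega -> 'cV[R]_n).

Lemma history_preimage s t B : 0 <= s -> s <= t -> measurable B ->
  history W t (W s @^-1` B).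
Proof. by move=> s0 st mB; apply: sub_sigma_algebra; exists s, B. Qed.

Lemma history_completed t A : history W t A -> completed_history P W t A.
Proof. by move=> hA; apply: sub_sigma_algebra; left. Qed.

Lemma negligible_completed t A : P.-negligible A -> completed_history P W t A.
Proof. by move=> hA; apply: sub_sigma_algebra; right. Qed.

Lemma sigma_algebra_completed t : sigma_algebra setT (completed_history P W t).
Proof. exact: smallest_sigma_algebra. Qed.

Lemma completedC t A : completed_history P W t A -> completed_history P W t (~` A).
Proof. by case: (sigma_algebra_completed t) => _ + _ => /[apply]; rewrite setTD. Qed.

Lemma completedU t A B : completed_history P W t A -> completed_history P W t B ->
  completed_history P W t (A `|` B).
Proof.
move=> hA hB; rewrite -bigcup2E; case: (sigma_algebra_completed t) => h0 _.
by apply => -[|[|k]].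
Qed.

Lemma completedI t A B : completed_history P W t A -> completed_history P W t B ->
  completed_history P W t (A `&` B).
Proof.
move=> hA hB; rewrite -[A `&` B]setCK setCI.
by apply: completedC; apply: completedU; exact: completedC.
Qed.

Lemma completedT t : completed_history P W t setT.
Proof. by rewrite -setC0; apply: completedC; case: (sigma_algebra_completed t). Qed.

Lemma completed_ae t A B : completed_history P W t A ->
  (\forall w \ae P, A w <-> B w) -> completed_history P W t B.
Proof.
move=> hA /negligibleS AB.
pose N := [set w | ~ (A w <-> B w)].
have -> : B = (A `&` ~` N) `|` (B `&` N).
  apply/seteqP; split => w /=; rewrite /N/=; last first.
    by move=> [[Aw /contrapT [+ _]]|[]//]; apply.
  move=> Bw; have [ABw|ABw] := pselect (A w <-> B w); [left|by right].
  by split; [exact/ABw|apply].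
apply: completedU.
  apply: completedI => //; apply: completedC.
  by apply: negligible_completed; apply: AB.
by apply: negligible_completed; apply: AB => w [].
Qed.

(** The sets that agree with one of the history up to a null set form a
    sigma-algebra; this carries the independence of the increments from the
    history over to its completion. *)
Lemma completed_approx t A : completed_history P W t A ->
  exists2 B, history W t B & \forall w \ae P, A w <-> B w.
Proof.
pose S := [set A | exists2 B, history W t B & \forall w \ae P, A w <-> B w].
have [h0 hC hU] : sigma_algebra setT (history W t) by exact: smallest_sigma_algebra.
suff : completed_history P W t `<=` S by apply.
apply: smallest_sub; last first.
  move=> B [hB|[N [mN N0 BN]]].
    by exists B => //; apply: aeW.
  exists set0 => //; exists N; split => // w /= Bw; apply: BN.
  by apply: contrapT => nBw; apply: Bw; split.
split.
- by exists set0 => //; apply: aeW.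
- move=> B [C hCC BC]; exists (setT `\` C); first exact: hC.
  by apply: filterS BC => w [h1 h2]; split => -[_ h]; split => // ?; apply: h; auto.
- move=> F SF; have /choice[G FG] : forall k, exists B,
      history W t B /\ \forall w \ae P, F k w <-> B w.
    by move=> k; have [B hB FB] := SF k; exists B.
  exists (\bigcup_k G k).
    by apply: hU => k; have [] := FG k.
  have : \forall w \ae P, forall k, F k w <-> G k w.
    by apply: ae_foralln => k; have [] := FG k.
  by apply: filterS => w FGw; split => -[k _ h]; exists k => //; exact/FGw.
Qed.

Lemma history_mono s t : s <= t -> history W s `<=` history W t.
Proof.
move=> st; apply: smallest_sub; first exact: smallest_sigma_algebra.
move=> _ [r [B [r0 rs mB ->]]]; apply: history_preimage => //.
exact: le_trans rs st.
Qed.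

Lemma completed_mono s t : s <= t ->
  completed_history P W s `<=` completed_history P W t.
Proof.
move=> st; apply: smallest_sub; first exact: smallest_sigma_algebra.
move=> A [hA|]; last exact: negligible_completed.
by apply: history_completed; exact: history_mono hA.
Qed.

Hypothesis Pc : measure_is_complete P.
Hypothesis WB : standard_brownian_motion P W.

Lemma measurable_brownian t : 0 <= t -> measurable_fun setT (W t).
Proof. by case: WB => + _ _ _ _; apply. Qed.

Lemma history_measurable t : history W t `<=` measurable.
Proof.
apply: smallest_sub; first exact: sigma_algebra_measurable.
move=> _ [r [B [r0 rs mB ->]]].
exact: preimage_measurable (measurable_brownian r0) mB.
Qed.

Lemma completed_measurable t : completed_history P W t `<=` measurable.
Proof.
apply: smallest_sub; first exact: sigma_algebra_measurable.
by move=> A [/history_measurable//|/Pc].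
Qed.

Lemma measurable_increment s t : 0 <= s -> s <= t ->
  measurable_fun setT (fun w => W t w - W s w).
Proof.
move=> s0 st; apply: measurable_cVB; apply: measurable_brownian => //.
exact: le_trans st.
Qed.

Lemma increment_law s t B : 0 <= s -> s < t -> measurable B ->
  P [set w | B (W t w - W s w)] =
  (\int[lebesgue_cV R n]_(x in B) (gauss_pdf (t - s) x)%:E)%E.
Proof.
move=> s0 st mB; have mD := measurable_increment s0 (ltW st).
apply: (@eq_measure_box R n (image_measure P mD)
  (density (lebesgue_cV R n) (@measurable_gauss_pdf R n (t - s))
     (@gauss_pdf_ge0 R n (t - s)))) mB => [B' mB'|k].
  rewrite image_measureE densityE integral_gauss_pdf_box//.
  by case: WB => _ _ _ _; apply.
rewrite image_measureE (le_lt_trans (probability_le1 _ _)) ?ltry//.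
by apply: preimage_measurable => //; exact: measurable_box.
Qed.

Lemma brownian0 : \forall w \ae P, W 0 w = 0.
Proof. by case: WB. Qed.

Lemma marginal_law t B : 0 < t -> measurable B ->
  P (W t @^-1` B) =
  (\int[lebesgue_cV R n]_(x in B) (gauss_pdf t x)%:E)%E.
Proof.
move=> t0 mB; rewrite -[X in gauss_pdf X]subr0 -increment_law//.
apply: eq_measure_ae.
- exact: preimage_measurable (measurable_brownian (ltW t0)) mB.
- exact: preimage_measurable (measurable_increment (lexx 0) (ltW t0)) mB.
- by apply: filterS brownian0 => w /= ->; rewrite subr0.
Qed.

(** The law of W t is absolutely continuous for t > 0. *)
Lemma ae_brownian t (Q : 'cV[R]_n -> Prop) : 0 < t ->
  (\forall x \ae lebesgue_cV R n, Q x) -> \forall w \ae P, Q (W t w).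
Proof.
move=> t0 [N [mN N0 QN]]; exists (W t @^-1` N); split.
- exact: preimage_measurable (measurable_brownian (ltW t0)) mN.
- rewrite marginal_law//; apply: null_set_integral => //.
  by apply/measurable_EFinP/measurable_funTS; exact: measurable_gauss_pdf.
- by move=> w /= h; apply: QN.
Qed.

Lemma increment_indep s t A B : 0 <= s -> s < t ->
  completed_history P W s A -> measurable B ->
  P (A `&` [set w | B (W t w - W s w)]) =
  (P A * P [set w | B (W t w - W s w)%R])%E.
Proof.
move=> s0 st hA mB; have [A' hA' AA'] := completed_approx hA.
have mA := completed_measurable hA; have mA' := history_measurable hA'.
have mD : measurable [set w | B (W t w - W s w)].
  exact: preimage_measurable (measurable_increment s0 (ltW st)) mB.
rewrite (eq_measure_ae mA mA' AA').
rewrite (eq_measure_ae (measurableI _ _ mA mD) (measurableI _ _ mA' mD)); last first.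
  by apply: filterS AA' => w [h1 h2]; split => -[? ?]; split => //; auto.
by case: WB => _ _ _ + _; apply.
Qed.

End brownian_filtration.

(** Distributions are attached to bundled functions, whereas W t is measurable
    for t >= 0 only. *)
Definition mfun_of d1 d2 (T1 : measurableType d1) (T2 : measurableType d2)
    (f : T1 -> T2) (mf : measurable_fun setT f) : {mfun T1 >-> T2} :=
  HB.pack f (isMeasurableFun.Build _ _ _ _ f mf).

(** * Brownian martingales g(W) of at most linear variance *)

Section martingale_additive.
Context (R : realType) d (Omega : measurableType d) (P : probability Omega R)
  (n : nat) (W : R -> Omega -> 'cV[R]_n).
Hypothesis WB : standard_brownian_motion P W.
Local Notation lam := (lebesgue_cV R n).

Let mW t (t0 : 0 < t) : {mfun Omega >-> 'cV[R]_n} :=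
  mfun_of (measurable_brownian WB (ltW t0)).

Let lawE t (t0 : 0 < t) A : measurable A -> distribution P (mW t0) A =
  (\int[lam]_(x in A) (gauss_pdf t x)%:E)%E.
Proof. by move=> mA; exact: (marginal_law WB t0 mA). Qed.

Lemma ge0_integral_brownian t (F : 'cV[R]_n -> \bar R) : 0 < t ->
  measurable_fun setT F -> (forall x, 0 <= F x)%E ->
  (\int[P]_w F (W t w) = \int[lam]_x (F x * (gauss_pdf t x)%:E))%E.
Proof.
move=> t0 mF F0.
rewrite -(ge0_integral_density (@measurable_gauss_pdf R n t)
  (@gauss_pdf_ge0 R n t) (@lawE t t0))//.
by rewrite ge0_integral_distribution.
Qed.

Lemma integral_brownian t (F : 'cV[R]_n -> R) : 0 < t ->
  measurable_fun setT F -> P.-integrable setT (fun w => (F (W t w))%:E) ->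
  (\int[P]_w (F (W t w))%:E = \int[lam]_x (F x * gauss_pdf t x)%:E)%E.
Proof.
move=> t0 mF iF.
rewrite -(integral_density (@measurable_gauss_pdf R n t)
  (@gauss_pdf_ge0 R n t) (@lawE t t0))//.
rewrite integral_distribution//; exact/measurable_EFinP.
Qed.

Variables (g : 'cV[R]_n -> R).
Hypothesis mg : measurable_fun setT g.
Hypothesis ig : forall t, 0 < t -> P.-integrable setT (fun w => (g (W t w))%:E).
Hypothesis gM : forall s t B, 0 < s -> s <= t -> measurable B ->
  (\int[P]_(w in W s @^-1` B) (g (W t w))%:E =
   \int[P]_(w in W s @^-1` B) (g (W s w))%:E)%E.

(** The martingale property between times 1 and 1 + u says that g is invariant
    under the heat semigroup, at almost every point. *)
Lemma martingale_heat_invariant u : 0 < u -> \forall x \ae lam,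
  ((g x)%:E = \int[lam]_z (g z * gauss_pdf u (z - x))%:E)%E.
Proof.
move=> u0; have lt1 : 1 < 1 + u by rewrite ltrDl.
pose X := mW ltr01.
pose Z := mfun_of (measurable_increment WB ler01 (ltW lt1)).
have ZE w : Z w = W (1 + u) w - W 1 w by [].
have XZ A B : measurable A -> measurable B ->
    P (X @^-1` A `&` Z @^-1` B) = (P (X @^-1` A) * P (Z @^-1` B))%E.
  move=> mA mB; case: WB => _ _ _ + _; apply => //.
  exact: history_preimage.
pose F (z : 'cV[R]_n * 'cV[R]_n) := (g (z.1 + z.2))%:E.
have mF : measurable_fun setT F.
  by apply/measurable_EFinP; apply: measurableT_comp => //; exact: measurable_cVD.
have FE w : F (X w, Z w) = (g (W (1 + u) w))%:E by rewrite /F/= addrC subrK.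
have iF : (distribution P X \x distribution P Z)%E.-integrable setT F.
  apply/(integrable_joint_law XZ mF); under eq_fun do rewrite FE.
  by apply: ig; rewrite addr_gt0.
pose T := fubini_F (distribution P Z) F.
have iT : (distribution P X).-integrable setT T by exact: integrable_fubini_F.
have TE x : T x = (\int[lam]_z (g z * gauss_pdf u (z - x))%:E)%E.
  have lawZ A : measurable A -> distribution P Z A =
      (\int[lam]_(z in A) (gauss_pdf u z)%:E)%E.
    move=> mA; have := increment_law WB ler01 lt1 mA.
    by rewrite (_ : 1 + u - 1 = u) => [<-//|]; ring.
  rewrite /T /fubini_F /F/= (integral_density (@measurable_gauss_pdf R n u)
    (@gauss_pdf_ge0 R n u) lawZ); last first.
    by apply: measurableT_comp => //; exact: measurable_cVD.
  rewrite -(integral_translation (- x)); last first.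
    apply/measurable_EFinP; apply: measurable_funM; last exact: measurable_gauss_pdf.
    by apply: measurableT_comp => //; exact: measurable_cVD.
  by apply: eq_integral => z _; rewrite /= addrCA subrr addr0.
have igX : (distribution P X).-integrable setT (EFin \o g).
  apply: integrable_pushforward => //; first exact/measurable_EFinP.
  exact: ig.
have gT : ae_eq (distribution P X) setT T (EFin \o g).
  apply: integral_ae_eq => //; first by case/integrableP: igX.
  move=> E _ mE.
  rewrite [RHS]integral_pushforward//; first last.
  - apply: (integrableS measurableT _ _ (ig ltr01)) => //.
    exact: preimage_measurable.
  - exact/measurable_EFinP.
  rewrite -(gM ltr01 (ltW lt1) mE).
  transitivity (\int[P]_(w in [set w | (E `*` setT) (X w, Z w)]) F (X w, Z w))%E; last first.
    rewrite (_ : [set w | _] = W 1 @^-1` E); first by apply: eq_integral => w _; exact: FE.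
    by apply/seteqP; split => [w [] //|w Ew]; split.
  have mET : measurable (E `*` [set: 'cV[R]_n]) by exact: measurableX.
  rewrite -(integral_joint_law XZ mET mF) [RHS]integral_mkcond.
  rewrite -integral12_prod_meas1; last first.
    by apply/(integrable_mkcond _ mET); exact: integrableS iF.
  rewrite integral_mkcond; apply: eq_integral => x _.
  rewrite patchE /fubini_F; case: ifPn => xE.
    apply: eq_integral => y _; rewrite patchE mem_set//.
    by split => //; rewrite inE in xE.
  rewrite integral0_eq// => y _; rewrite patchE memNset// => -[/= Ex _].
  by rewrite mem_set in xE.
case: gT => N [mN NX TN].
have N0 : (\int[lam]_(x in N) (gauss_pdf 1 x)%:E = 0)%E.
  by rewrite -(lawE ltr01 mN).
have : ae_eq lam N (EFin \o gauss_pdf 1) (cst 0%E).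
  apply/ae_eq_integral_abs => //.
    by apply/measurable_EFinP/measurable_funTS; exact: measurable_gauss_pdf.
  rewrite -[RHS]N0; apply: eq_integral => x _.
  by rewrite gee0_abs// lee_fin gauss_pdf_ge0.
apply: filterS => x px; rewrite -TE; apply/esym.
apply: contrapT => h; have Nx : N x by apply: TN => /= /(_ I).
have := px Nx; apply/eqP; rewrite gt_eqF// lte_fin gauss_pdf_gt0//.
Qed.

Variable C : R.
Hypothesis g0 : forall t, 0 < t -> (\int[P]_w (g (W t w))%:E = 0)%E.
Hypothesis g2 : forall t, 0 < t ->
  (\int[P]_w ((g (W t w)) ^+ 2)%:E <= (C * t)%:E)%E.

Lemma martingale_additive : \forall z \ae lebesgue_cV R (n + n),
  g (usubmx z + dsubmx z) = g (usubmx z) + g (dsubmx z).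
Proof.
apply: (@heat_additive R n g C) => // k.
- have k0 : 0 < k.+1%:R :> R by rewrite ltr0n.
  apply: le_trans (g2 k0).
  rewrite (ge0_integral_brownian (F := fun x => (g x ^+ 2)%:E))//.
    by apply/measurable_EFinP; exact: measurable_funX.
  by move=> x; rewrite lee_fin sqr_ge0.
- have k0 : 0 < k.+1%:R :> R by rewrite ltr0n.
  by rewrite -integral_brownian// ?g0//; exact: ig.
- by apply: martingale_heat_invariant; rewrite ltr0n.
Qed.

End martingale_additive.

(** * Moments of martingales with a Lipschitz square characteristic *)

Lemma integrable_ae_eq d (T : measurableType d) (R : realType)
    (mu : {measure set T -> \bar R}) (f g : T -> \bar R) :
  measurable_fun setT g -> (\forall x \ae mu, f x = g x) ->
  mu.-integrable setT f -> mu.-integrable setT g.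
Proof.
move=> mg fg /integrableP[mf fi]; apply/integrableP; split => //.
rewrite (ae_eq_integral (fun x => `|f x|%E))//.
- exact: measurableT_comp.
- exact: measurableT_comp.
- by apply: filterS fg => x -> _.
Qed.

Section square_characteristic_bound.
Context (R : realType) d (Omega : measurableType d) (P : probability Omega R).
Variables (F : R -> set (set Omega)) (M A : R -> Omega -> R) (C t : R).
Local Open Scope ereal_scope.

(** The localized processes M^2 - A have constant expectation 0; as A s <= C s,
    Fatou's lemma gives the bound for M itself. *)
Lemma square_characteristic_bound :
  F 0%R setT -> square_characteristic P F M A ->
  (\forall w \ae P, M 0%R w = 0%R) ->
  (\forall w \ae P, forall r s, (0 <= r)%R -> (r <= s)%R ->
     (A s w - C * s <= A r w - C * r)%R) ->
  (0 <= t)%R -> measurable_fun setT (M t) ->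
  \int[P]_w ((M t w) ^+ 2)%:E <= (`|C| * t)%:E.
Proof.
move=> FT [M' [MM' _ _ [_ A0 [tau [tau_st tau_oo] Nmart]]]] M0 AC t0 mM.
pose Y k s w := stopped (fun s w => M' s w ^+ 2 - A s w)%R (tau k) s w.
have Y0 k : \forall w \ae P, Y k 0%R w = 0%R.
  apply: filterS (filterI A0 (filterI M0 (MM' 0%R (lexx _)))) => w [[A0w _ _] [M0w MM'w]].
  rewrite /Y /stopped min_l; last by have [+ _] := tau_st k.
  by rewrite /= -MM'w M0w A0w expr0n subrr.
have mY k s : (0 <= s)%R -> measurable_fun setT (Y k s).
  move=> s0; have [_ + _] := Nmart k => /(_ s s0) /integrableP[+ _].
  by move/measurable_EFinP.
have EY k : \int[P]_w (Y k t w)%:E = 0.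
  have [_ _ /(_ 0%R t (lexx _) t0) [_ _ /(_ _ FT) <-]] := Nmart k.
  rewrite (ae_eq_integral (cst 0))//; first exact: integral0.
  - by apply/measurable_EFinP; exact: mY.
  - by apply: filterS (Y0 k) => w Y0w _ /=; rewrite -[X in X%:E = _]/(Y k 0%R w) Y0w.
pose Z k w := Num.max 0%R (Y k t w + `|C| * t)%R.
have ZY : \forall w \ae P, forall k, Z k w = (Y k t w + `|C| * t)%R.
  apply: filterS2 A0 AC => w [A0w Aw _] ACw k.
  rewrite /Z max_r// /Y /stopped; set r := fine _.
  have tau0 : 0 <= tau k w by have [+ _] := tau_st k.
  have [r0 rt] : (0 <= r /\ r <= t)%R.
    rewrite /r; case: (tau k w) tau0 => [x||//]; last by rewrite min_l ?leey.
    rewrite lee_fin => x0; rewrite -EFin_min /=; split; last by rewrite ge_min lexx.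
    by rewrite le_min t0 x0.
  have := ACw 0%R r (lexx _) r0; rewrite A0w mulr0 subr0.
  have : (C * r <= `|C| * t)%R.
    by rewrite (le_trans (ler_norm _))// normrM (ger0_norm r0) ler_wpM2l.
  by have := sqr_ge0 (M' r w); lra.
have mZ k : measurable_fun setT (fun w => (Z k w)%:E).
  apply/measurable_EFinP; apply: measurable_maxr => //; apply: measurable_funD => //.
  exact: mY.
have EZ k : \int[P]_w (Z k w)%:E = (`|C| * t)%:E.
  transitivity (\int[P]_w ((Y k t w)%:E + (`|C| * t)%:E)).
    apply: ae_eq_integral => //.
    - by apply: emeasurable_funD => //; apply/measurable_EFinP; exact: mY.
    - by apply: filterS ZY => w Zw _; rewrite Zw EFinD.
  rewrite integralD//; last 2 first.
  - by have [_ /(_ t t0)] := Nmart k.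
  - exact: finite_measure_integrable_cst.
  by rewrite EY add0e integral_cst//= probability_setT mule1.
have -> : (`|C| * t)%:E = limn_einf (fun k => \int[P]_w (Z k w)%:E).
  under eq_fun do rewrite EZ.
  have c_cvg : (fun _ : nat => (`|C| * t)%:E) @ \oo --> (`|C| * t)%:E by exact: cvg_cst.
  rewrite is_cvg_limn_einfE; last exact: cvgP c_cvg.
  by rewrite (cvg_lim _ c_cvg).
have Zge0 k w : setT w -> 0 <= (Z k w)%:E by rewrite lee_fin le_max lexx.
apply: (le_trans _ (fatou P measurableT mZ Zge0)).
apply: ae_ge0_le_integral => //.
- by move=> w _; rewrite lee_fin sqr_ge0.
- by apply/measurable_EFinP; exact: measurable_funX.
- move=> w _; rewrite limn_einf_lim; apply: lime_ge; first exact: is_cvg_einfs.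
  by apply: nearW => k; apply: le_ereal_inf_tmp => _ [i _ <-]; exact: Zge0.
(* measurability of a lower limit, from that of an upper limit *)
- rewrite (_ : (fun w => _) = (fun w => - limn_esup (fun k => - (Z k w)%:E))).
    apply: measurableT_comp => //; apply: measurable_fun_limn_esup => k.
    exact: measurableT_comp.
  apply/funext => w; rewrite -limn_einfN; congr limn_einf.
  by apply/funext => k; rewrite /comp oppeK.
apply: filterS (filterI (filterI ZY (MM' t t0)) (filterI (filterI A0 AC) tau_oo)).
move=> w [[Zw MMw] [[[A0w _ _] ACw] [_ tauw]]] _.
have Zcvg : (fun k => (Z k w)%:E) @ \oo --> (M' t w ^+ 2 - A t w + `|C| * t)%:E.
  apply: cvg_near_cst; have /cvgeyPge /(_ t) := tauw.
  apply: filterS => k tk; rewrite Zw /Y /stopped min_l//.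
rewrite is_cvg_limn_einfE; last exact: cvgP Zcvg.
rewrite (cvg_lim _ Zcvg)// lee_fin MMw.
have := ACw 0%R t (lexx _) t0; rewrite A0w mulr0 subr0.
have : (C * t <= `|C| * t)%R by rewrite ler_wpM2r// ler_norm.
lra.
Qed.

End square_characteristic_bound.

Section martingale_cauchy.
Context (R : realType) d (Omega : measurableType d) (P : probability Omega R)
  (n m : nat) (W : R -> Omega -> 'cV[R]_n) (f : 'cV[R]_n -> 'cV[R]_m).
Hypothesis Pc : measure_is_complete P.
Hypothesis WB : standard_brownian_motion P W.
Hypothesis f0 : f 0 = 0.

(** The values of W at time 0 enter through f 0 = 0 alone, and at positive times
    f may be replaced by a Borel representative. *)
Lemma martingale_cauchy : martingale_transform P W f -> cauchy_equation_ae f.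
Proof.
move=> [mf Mf Qf]; split => //.
have [g mg fg] := borel_representative_cV mf.
apply: (@cauchy_equation_ae_congr _ _ _ g); first by apply: filterS fg => x ->.
suff : \forall z \ae lebesgue_cV R (n + n), forall j,
    g (usubmx z + dsubmx z) j ord0 = g (usubmx z) j ord0 + g (dsubmx z) j ord0.
  by apply: filterS => z gz; apply/colP => j; rewrite mxE gz.
apply: filter_forall => j.
pose gj x := g x j ord0; pose M t w := f (W t w) j ord0.
have mgj : measurable_fun setT gj by exact: measurable_cV_entry.
have mgW t : 0 < t -> measurable_fun setT (fun w => gj (W t w)).
  by move=> t0; exact: measurableT_comp mgj (measurable_brownian WB (ltW t0)).
have Mg t : 0 < t -> \forall w \ae P, M t w = gj (W t w).
  by move=> t0; apply: filterS (ae_brownian WB t0 fg) => w; rewrite /M => ->.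
have M0 : \forall w \ae P, M 0 w = 0.
  by apply: filterS (brownian0 WB) => w; rewrite /M => ->; rewrite f0 mxE.
have [_ iM condM] := Mf j.
have mM t : 0 <= t -> measurable_fun setT (fun w => (M t w)%:E).
  by move=> t0; have /integrableP[] := iM t t0.
have condE s t B : 0 <= s -> s <= t -> completed_history P W s B ->
    (\int[P]_(w in B) (M t w)%:E = \int[P]_(w in B) (M s w)%:E)%E.
  by move=> s0 st hB; have [_ _ ->] := condM s t s0 st.
have [C [A [MA AC]]] := Qf j.
apply: (@martingale_additive R _ _ P n W WB gj mgj _ _ `|C|) =>
  [t t0|s t B s0 st mB|t t0|t t0].
- apply: integrable_ae_eq (iM t (ltW t0)); first exact/measurable_EFinP/mgW.
  by apply: filterS (Mg t t0) => w; rewrite /M/= => ->.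
- have hB : completed_history P W s (W s @^-1` B).
    by apply: history_completed; apply: history_preimage => //; exact: ltW.
  have mB' := completed_measurable Pc WB hB.
  have MgE r : 0 < r -> (\int[P]_(w in W s @^-1` B) (M r w)%:E =
      \int[P]_(w in W s @^-1` B) (gj (W r w))%:E)%E.
    move=> r0; apply: ae_eq_integral => //.
    - exact/measurable_funTS/mM/ltW.
    - by apply/measurable_EFinP/measurable_funTS; exact: mgW.
    - by apply: filterS (Mg r r0) => w ->.
  rewrite -MgE ?(lt_le_trans s0 st)// -MgE//.
  by apply: condE => //; exact: ltW.
- transitivity (\int[P]_w (M t w)%:E)%E.
    apply: ae_eq_integral => //.
    + by apply/measurable_EFinP; exact: mgW.
    + exact/mM/ltW.
    + by apply: filterS (Mg t t0) => w ->.
  rewrite (condE 0 t setT (lexx _) (ltW t0) (@completedT _ _ _ P n W 0)).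
  rewrite (ae_eq_integral (cst 0%E))//; first exact: integral0.
  + exact: mM.
  + by apply: filterS M0 => w ->.
- rewrite [leLHS](_ : _ = \int[P]_w (M t w ^+ 2)%:E)%E; last first.
    apply: ae_eq_integral => //.
    + by apply/measurable_EFinP; apply: measurable_funX; exact: mgW.
    + apply/measurable_EFinP; apply: measurable_funX.
      by apply/measurable_EFinP; exact/mM/ltW.
    + by apply: filterS (Mg t t0) => w ->.
  apply: (square_characteristic_bound (@completedT _ _ _ P n W 0) MA M0 AC (ltW t0)).
  by apply/measurable_EFinP; exact/mM/ltW.
Qed.

End martingale_cauchy.

(** * Linear functions of Brownian motion *)

Section gauss_moments.
Context (R : realType) (n : nat) (a : 'cV[R]_n).
Local Notation lam := (lebesgue_cV R n).
Local Notation p := (@gauss_pdf R n).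

Lemma gauss_pdfN u (x : 'cV[R]_n) : 0 < u -> p u (- x) = p u x.
Proof. by move=> u0; rewrite !gauss_pdfE// dotNl dotNr opprK. Qed.

Lemma gauss_pdf_scale u (x : 'cV[R]_n) : 0 < u ->
  p u (Num.sqrt u *: x) = (Num.sqrt u)^-1 ^+ n * p 1 x.
Proof.
move=> u0; have su0 : 0 < Num.sqrt u by rewrite sqrtr_gt0.
rewrite !gauss_pdfE// dotZl dotZr [RHS]mulrA -exprMn; congr (_ ^+ n * expR _).
  rewrite /normal_peak sqrtr1 expr1n mul1r -invfM; congr (_^-1).
  by rewrite -mulrnAr sqrtrM ?sqr_ge0// sqrtr_sqr gtr0_norm.
have -> : u = Num.sqrt u ^+ 2 by rewrite sqr_sqrtr// ltW.
rewrite sqrtr_sqr gtr0_norm//; field.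
by rewrite gt_eqF.
Qed.

(** Completing the square. *)
Lemma gauss_pdf_exp u (x : 'cV[R]_n) : 0 < u ->
  expR (dot a x) * p u x = expR (u * dot a a / 2) * p u (x - u *: a).
Proof.
move=> u0; rewrite !gauss_pdfE// mulrCA [RHS]mulrCA -!expRD; congr (_ * expR _).
rewrite !dotDl !dotDr !dotNl !dotNr !dotZl !dotZr (dotC x a).
by field; rewrite gt_eqF.
Qed.

Lemma integrable_gauss_pdf_exp u : 0 < u ->
  lam.-integrable setT (fun x => (expR (dot a x) * p u x)%:E).
Proof.
move=> u0; under eq_fun do rewrite gauss_pdf_exp// EFinM.
by apply: integrableZl => //; exact: integrable_gauss_pdfB.
Qed.

End gauss_moments.

Section gauss_second_moment.
Context (R : realType) (n : nat) (a : 'cV[R]_n).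
Local Notation lam := (lebesgue_cV R n).
Local Notation p := (@gauss_pdf R n).

Let measurable_dota : measurable_fun setT (dot a).
Proof. by apply: measurable_dot => //; exact: measurable_cst. Qed.

Lemma sqr_le_expR (t : R) : t ^+ 2 <= 2 * expR t + 2 * expR (- t).
Proof.
suff sqr_le (s : R) : 0 <= s -> s ^+ 2 <= 2 * expR s.
  have [t0|/ltW t0] := leP 0 t.
    by rewrite (le_trans (sqr_le _ t0))// lerDl mulr_ge0 ?expR_ge0.
  rewrite -sqrrN (le_trans (sqr_le (- t) _)) ?oppr_ge0//.
  by rewrite lerDr mulr_ge0 ?expR_ge0.
by move=> s0; have := expR_ge1Dxn 1 s0; rewrite (_ : 2`!%:R = 2)//; lra.
Qed.

(** The exponentials of dot a and of its opposite dominate its square. *)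
Lemma integrable_gauss_dot2 u : 0 < u ->
  lam.-integrable setT (fun x => (dot a x ^+ 2 * p u x)%:E).
Proof.
move=> u0.
have mf : measurable_fun setT (fun x => (dot a x ^+ 2 * p u x)%:E).
  apply/measurable_EFinP; apply: measurable_funM; last exact: measurable_gauss_pdf.
  exact: measurable_funX.
pose h x := (2%:E * (expR (dot a x) * p u x)%:E +
  2%:E * (expR (dot (- a) x) * p u x)%:E)%E.
have ih : lam.-integrable setT h.
  by apply: integrableD => //; apply: integrableZl => //;
    exact: integrable_gauss_pdf_exp.
apply: le_integrable ih => // x _; rewrite /h -!EFinM -EFinD /= lee_fin.
have pu := gauss_pdf_ge0 u x.
rewrite [leLHS]ger0_norm; last by rewrite mulr_ge0 ?sqr_ge0.
apply: le_trans (ler_norm _).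
by rewrite !mulrA -mulrDl ler_wpM2r// dotNl sqr_le_expR.
Qed.

(** The variance of dot a X for a standard Gaussian vector X. *)
Definition gauss_var : R := fine (\int[lam]_x (dot a x ^+ 2 * p 1 x)%:E)%E.

(** The substitution of sqrt u x for x. *)
Lemma integral_gauss_dot2 u : 0 < u ->
  (\int[lam]_x (dot a x ^+ 2 * p u x)%:E = (gauss_var * u)%:E)%E.
Proof.
move=> u0; have su0 : 0 < Num.sqrt u by rewrite sqrtr_gt0.
have i1 := integrable_gauss_dot2 ltr01; have iu := integrable_gauss_dot2 u0.
have := integral_affine 0 (lt0r_neq0 su0) iu.
under eq_integral => x _.
  rewrite addr0 gauss_pdf_scale// dotZr exprMn sqr_sqrtr ?ltW//.
  rewrite (_ : u * _ * _ =
    (Num.sqrt u)^-1 ^+ n * u * (dot a x ^+ 2 * p 1 x)); last by ring.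
  rewrite EFinM.
  over.
rewrite integralZl//= gtr0_norm// /gauss_var.
move: (integrable_fin_num measurableT i1) (integrable_fin_num measurableT iu).
move: (integral _ _ _) (integral _ _ _) => I1 Iu /fineK <- /fineK <-.
rewrite -!EFinM => -[] E; congr EFin.
apply: (@mulfI _ ((Num.sqrt u)^-1 ^+ n)); first by rewrite expf_neq0// invr_eq0 gt_eqF.
by rewrite -E /=; ring.
Qed.

Lemma integrable_gauss_dot u : 0 < u ->
  lam.-integrable setT (fun x => (dot a x * p u x)%:E).
Proof.
move=> u0.
have mf : measurable_fun setT (fun x => (dot a x * p u x)%:E).
  by apply/measurable_EFinP; apply: measurable_funM; last exact: measurable_gauss_pdf.
have ih := integrableD measurableT (integrable_gauss_pdf n u)
  (integrable_gauss_dot2 u0).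
apply: le_integrable ih => // x _; rewrite /= lee_fin normrM.
have pu := gauss_pdf_ge0 u x.
rewrite (ger0_norm pu) (le_trans _ (ler_norm _))//.
rewrite -[X in X + _]mul1r -mulrDl ler_wpM2r// -real_normK ?num_real//.
have := sqr_ge0 (`|dot a x| - 1); have := normr_ge0 (dot a x); lra.
Qed.

(** The integrand is odd. *)
Lemma integral_gauss_dot u : 0 < u ->
  (\int[lam]_x (dot a x * p u x)%:E = 0)%E.
Proof.
move=> u0; have iu := integrable_gauss_dot u0.
have N1 : (-1 : R) != 0 by rewrite oppr_eq0 oner_neq0.
have := integral_affine 0 N1 iu.
rewrite normrN1 invr1 expr1n mul1e.
under eq_integral do rewrite addr0 scaleN1r gauss_pdfN// dotNr mulNr EFinN.
rewrite integralN/=; last exact: integrable_add_def.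
rewrite -(fineK (integrable_fin_num measurableT iu)) => /eqP.
rewrite -EFinN eqe => /eqP h; congr (_%:E); lra.
Qed.

End gauss_second_moment.

Section linear_brownian.
Context (R : realType) d (Omega : measurableType d) (P : probability Omega R)
  (n : nat) (W : R -> Omega -> 'cV[R]_n) (a : 'cV[R]_n).
Hypothesis Pc : measure_is_complete P.
Hypothesis WB : standard_brownian_motion P W.
Local Notation F := (completed_history P W).
Local Notation lam := (lebesgue_cV R n).
Local Notation c := (gauss_var a).

Let measurable_dota : measurable_fun setT (dot a).
Proof. by apply: measurable_dot => //; exact: measurable_cst. Qed.

Lemma integral_indicM A (f : Omega -> R) :
  (\int[P]_(w in A) (f w)%:E = \int[P]_w (\1_A w * f w)%:E)%E.
Proof.
rewrite integral_mkcond; apply: eq_integral => w _; rewrite patchE indicE.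
by case: ifP => _; rewrite ?mul1r ?mul0r.
Qed.

Section increment.
Variables (s t : R).
Hypotheses (s0 : 0 <= s) (st : s < t).

Let Z := mfun_of (measurable_increment WB s0 (ltW st)).

Let lawZ A : measurable A -> distribution P Z A =
  (\int[lam]_(x in A) (gauss_pdf (t - s) x)%:E)%E.
Proof. by move=> mA; exact: (increment_law WB s0 st mA). Qed.

Let ts : 0 < t - s. Proof. by rewrite subr_gt0. Qed.

Lemma integrable_increment (G : 'cV[R]_n -> R) : measurable_fun setT G ->
  lam.-integrable setT (fun x => (G x * gauss_pdf (t - s) x)%:E) ->
  P.-integrable setT (fun w => (G (W t w - W s w))%:E).
Proof.
move=> mG /(integrable_density (@measurable_gauss_pdf R n (t - s))
  (@gauss_pdf_ge0 R n (t - s)) lawZ mG) /integrableP[mGE iG].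
apply/integrableP; split.
  exact: (measurableT_comp mGE (measurable_increment WB s0 (ltW st))).
move: iG; rewrite (@ge0_integral_distribution _ _ _ _ _ P Z)//.
exact: measurableT_comp.
Qed.

Lemma integral_increment (G : 'cV[R]_n -> R) : measurable_fun setT G ->
  lam.-integrable setT (fun x => (G x * gauss_pdf (t - s) x)%:E) ->
  (\int[P]_w (G (W t w - W s w))%:E =
   \int[lam]_x (G x * gauss_pdf (t - s) x)%:E)%E.
Proof.
move=> mG iG.
rewrite -(integral_density (@measurable_gauss_pdf R n (t - s))
  (@gauss_pdf_ge0 R n (t - s)) lawZ)//.
rewrite (@integral_distribution _ _ _ _ _ P Z)//; first exact/measurable_EFinP.
exact: integrable_increment.
Qed.

Lemma integrable_dot_increment :
  P.-integrable setT (fun w => (dot a (W t w - W s w))%:E).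
Proof. by apply: integrable_increment => //; exact: integrable_gauss_dot. Qed.

Lemma integral_dot_increment :
  (\int[P]_w (dot a (W t w - W s w))%:E = 0)%E.
Proof.
rewrite integral_increment//; first exact: integral_gauss_dot.
exact: integrable_gauss_dot.
Qed.

Lemma integrable_dot2_increment :
  P.-integrable setT (fun w => (dot a (W t w - W s w) ^+ 2)%:E).
Proof.
apply: (integrable_increment (G := fun x => dot a x ^+ 2)).
  exact: measurable_funX.
exact: integrable_gauss_dot2.
Qed.

Lemma integral_dot2_increment :
  (\int[P]_w (dot a (W t w - W s w) ^+ 2)%:E = (c * (t - s))%:E)%E.
Proof.
rewrite (integral_increment (G := fun x => dot a x ^+ 2)).
- exact: integral_gauss_dot2.
- exact: measurable_funX.
- exact: integrable_gauss_dot2.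
Qed.

Section conditional.
Variables (A : set Omega) (u v : 'cV[R]_n -> R).
Hypothesis FA : F s A.
Hypotheses (mu : measurable_fun setT u) (mv : measurable_fun setT v).
Hypothesis iu : P.-integrable setT (fun w => (u (W s w))%:E).
Hypothesis iv : P.-integrable setT (fun w => (v (W t w - W s w))%:E).

Let mA : measurable A := completed_measurable Pc WB FA.

(** Keeping the indicator of A next to W s makes an integral over the event A of
    the past an expectation of a product of independent variables. *)
Let mX : measurable_fun setT (fun w => (\1_A w : R, W s w)).
Proof.
apply: measurable_fun_pair; [exact: measurable_indic|exact: (measurable_brownian WB s0)].
Qed.

Let X := mfun_of mX.

Let XZ B D : measurable B -> measurable D ->
  P (X @^-1` B `&` Z @^-1` D) = (P (X @^-1` B) * P (Z @^-1` D))%E.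
Proof.
move=> mB mD; apply: (increment_indep Pc WB s0 st) mD.
have mS (r : R) : F s (W s @^-1` [set x | B (r, x)]).
  apply: history_completed; apply: history_preimage => //.
  apply: preimage_measurable mB.
  exact: measurable_fun_pair (measurable_cst r) (@measurable_id _ _ setT).
have -> : X @^-1` B = (A `&` W s @^-1` [set x | B (1, x)]) `|`
    (~` A `&` W s @^-1` [set x | B (0, x)]).
  apply/seteqP; split => w /=; rewrite indicE.
    have [Aw|Aw] := pselect (A w); first by rewrite mem_set//; left.
    by rewrite memNset//; right.
  by case=> -[Aw]; [rewrite mem_set|rewrite memNset].
by apply: completedU; apply: completedI => //; exact: completedC.
Qed.

Let U (z : R * 'cV[R]_n) := z.1 * u z.2.

Let mU : measurable_fun setT U.
Proof. by apply: measurable_funM => //; exact: measurableT_comp. Qed.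

Let iU : P.-integrable setT (fun w => (U (X w))%:E).
Proof.
apply: le_integrable iu => //.
  apply/measurable_EFinP; exact: measurableT_comp mU mX.
move=> w _; rewrite lee_fin /U/= normrM indicE.
by case: (w \in A); rewrite ?normr1 ?mul1r// normr0 mul0r.
Qed.

Lemma integrable_increment_mul :
  P.-integrable setT (fun w => (\1_A w * (u (W s w) * v (W t w - W s w)))%:E).
Proof.
have := integrable_mul_indep XZ mU mv iU iv.
by under eq_fun do rewrite /U/= -mulrA.
Qed.

Lemma integral_increment_mul :
  (\int[P]_w (\1_A w * (u (W s w) * v (W t w - W s w)))%:E =
   (\int[P]_w (\1_A w * u (W s w))%:E) *
   \int[P]_w (v (W t w - W s w))%:E)%E.
Proof.
rewrite -(integral_mul_indep XZ mU mv iU iv).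
by apply: eq_integral => w _; rewrite /U/= mulrA.
Qed.

End conditional.
End increment.
End linear_brownian.

(** * The square characteristic of a linear function of Brownian motion *)

Section filtered.
Context (R : realType) d (Omega : measurableType d) (P : probability Omega R).
Variable F : R -> set (set Omega).

Lemma martingale_of_increments (M : R -> Omega -> R) :
  (forall t, F t `<=` measurable) ->
  (forall t, 0 <= t -> measurable_wrt (F t) (M t)) ->
  (forall t, 0 <= t -> P.-integrable setT (fun w => (M t w)%:E)) ->
  (forall s t A, 0 <= s -> s < t -> F s A ->
     (\int[P]_w (\1_A w * (M t w - M s w))%:E = 0)%E) ->
  martingale P F M.
Proof.
move=> Fm mM iM M0; split => // s t s0 st; split; [exact: mM|exact: iM|].
move=> A FA; move: st; rewrite le_eqVlt => /predU1P[<-//|st].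
have t0 := le_trans s0 (ltW st); have mA := Fm _ _ FA.
have iA r : 0 <= r -> P.-integrable setT (fun w => (\1_A w * M r w)%:E).
  move=> r0; have /integrableP[mMr _] := iM r r0.
  apply: le_integrable (iM r r0) => //.
    apply/measurable_EFinP; apply: measurable_funM; first exact: measurable_indic.
    exact/measurable_EFinP.
  move=> w _; rewrite lee_fin normrM indicE.
  by case: (w \in A); rewrite ?normr1 ?mul1r// normr0 mul0r.
rewrite [LHS]integral_indicM [RHS]integral_indicM; have := M0 s t A s0 st FA.
under eq_integral do rewrite mulrBr EFinB.
rewrite integralB//; [|exact: iA|exact: iA].
have /fineK <- := integrable_fin_num measurableT (iA t t0).
have /fineK <- := integrable_fin_num measurableT (iA s s0).
by move=> /eqP; rewrite -EFinB eqe subr_eq0 => /eqP ->.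
Qed.

Lemma stopped_constE (M : R -> Omega -> R) (k : nat) :
  stopped M (fun=> k%:R%:E) = fun t => M (Num.min t k%:R).
Proof.
by apply/funext => t; apply/funext => w; rewrite /stopped -EFin_min.
Qed.

Lemma martingale_stopped_const (M : R -> Omega -> R) (k : nat) :
  (forall s t, s <= t -> F s `<=` F t) ->
  martingale P F M -> martingale P F (stopped M (fun=> k%:R%:E)).
Proof.
move=> Fmono [mM iM cM]; rewrite stopped_constE.
have min0 (t : R) : 0 <= t -> 0 <= Num.min t k%:R by move=> t0; rewrite le_min t0/=.
have minle (t : R) : Num.min t k%:R <= t by rewrite ge_min lexx.
have mMk t : 0 <= t -> measurable_wrt (F t) (M (Num.min t k%:R)).
  move=> t0 B mB; apply: Fmono (minle t) _ _.
  exact: (mM _ (min0 t t0)).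
split => //; first by move=> t t0; apply: iM; exact: min0.
move=> s t s0 st; split; [exact: mMk|exact/iM/min0|].
have t0 := le_trans s0 st.
move=> A FA; have [sk|/ltW ks] := leP s k%:R; last first.
  by rewrite (min_r (le_trans ks st)).
have smin : s <= Num.min t k%:R by rewrite le_min st.
by have [_ _ E] := cM _ _ s0 smin; exact: E.
Qed.

Lemma localizing_const :
  (forall t, sigma_algebra setT (F t)) ->
  localizing_sequence P F (fun k _ => k%:R%:E).
Proof.
move=> Fs; split.
  move=> k; split => [w|t t0]; first by rewrite lee_fin.
  have [F0 FC _] := Fs t.
  have [kt|kt] := boolP (k%:R <= t).
    rewrite (_ : [set _ | _] = setT `\` set0)//; first exact: FC.
    by rewrite setD0; apply/seteqP; split.
  rewrite (_ : [set _ | _] = set0)//; apply/seteqP; split => w //=.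
  by rewrite lee_fin (negbTE kt).
apply: aeW => w; split => [k|]; first by rewrite lee_fin ler_nat.
exact/cvgenyP.
Qed.

(** The half-lines ]x, +oo[ generate the Borel sets. In [0, +oo[ they are
    countable unions of intervals ]x, x + k + 1] if x >= 0, and the complement of
    the empty set if x < 0. *)
Lemma predictable_deterministic (h : R -> R) : measurable_fun setT h ->
  sigma_algebra setT (F 0) -> (forall s t, s <= t -> F s `<=` F t) ->
  predictable F (fun t _ => h t).
Proof.
move=> mh F0s Fmono B mB.
pose D0 := [set p : R * Omega | 0 <= p.1].
have FT s : 0 <= s -> F s setT.
  by move=> s0; apply: Fmono s0 _ _; case: F0s => h0 /(_ _ h0); rewrite setD0.
have [P0 PC PU] : sigma_algebra D0 (predictable_sets F) by exact: smallest_sigma_algebra.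
pose S := [set A : set R | predictable_sets F [set p | 0 <= p.1 /\ A p.1]].
suff mS : <<s @RGenOInfty.G R >> `<=` S.
  apply: (mS (h @^-1` B)); rewrite -[X in X _]RGenOInfty.measurableE.
  exact: preimage_measurable.
apply: smallest_sub.
  split.
  - by rewrite /S/= (_ : [set _ | _] = set0)//; apply/seteqP; split => p [].
  - move=> A SA; rewrite /S/= (_ : [set _ | _] = D0 `\` [set p | 0 <= p.1 /\ A p.1]).
      exact: PC.
    apply/seteqP; split => p /=; first by move=> [p0 [_ nA]]; split => // -[].
    by move=> [p0 h']; split => //; split => // Ap; apply: h'.
  - move=> G SG; rewrite /S/= (_ : [set _ | _] =
        \bigcup_k [set p : R * Omega | 0 <= p.1 /\ G k p.1]); first exact: PU.
    apply/seteqP; split => p /=; first by move=> [p0 [k _ Gk]]; exists k.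
    by move=> [k _ [p0 Gk]]; split => //; exists k.
move=> _ [x ->]; rewrite /S/=; have [x0|x0] := ltP x 0.
  rewrite (_ : [set _ | _] = D0 `\` set0); first exact: PC.
  rewrite setD0; apply/seteqP; split => p /=; first by case.
  by move=> p0; split => //; rewrite in_itv/= (lt_le_trans x0).
rewrite (_ : [set _ | _] = \bigcup_(k : nat) (`]x, x + k.+1%:R]%classic `*` [set: Omega])).
  apply: PU => k; apply: sub_sigma_algebra; right.
  by exists x, (x + k.+1%:R), setT; split => //; [rewrite ltrDl|exact: FT].
apply/seteqP; split => p /=.
  move=> [p0]; rewrite in_itv/= andbT => xp.
  exists (Num.bound (p.1 - x)) => //; split => //=; rewrite in_itv/= xp/=.
  rewrite -lerBlDl ltW// (lt_trans (archi_boundP _))//; first by rewrite subr_ge0 ltW.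
  by rewrite ltr_nat.
move=> [k _ []]/=; rewrite !in_itv/= => /andP[xp _] _; rewrite andbT; split => //.
exact: le_trans (ltW xp).
Qed.

End filtered.

Section linear_brownian_martingale.
Context (R : realType) d (Omega : measurableType d) (P : probability Omega R)
  (n : nat) (W : R -> Omega -> 'cV[R]_n) (a : 'cV[R]_n).
Hypothesis Pc : measure_is_complete P.
Hypothesis WB : standard_brownian_motion P W.
Local Notation F := (completed_history P W).
Local Notation c := (gauss_var a).
Local Notation L := (fun t w => dot a (W t w)).

Let measurable_dota : measurable_fun setT (dot a).
Proof. by apply: measurable_dot => //; exact: measurable_cst. Qed.

Let Fm t : F t `<=` measurable. Proof. exact: completed_measurable. Qed.

Let adapted t (u : 'cV[R]_n -> R) : 0 <= t -> measurable_fun setT u ->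
  measurable_wrt (F t) (fun w => u (W t w)).
Proof.
move=> t0 mu B mB; apply: history_completed.
by apply: (@history_preimage _ _ _ _ W t t (u @^-1` B)) => //; exact: preimage_measurable.
Qed.

Lemma ae_increment0 t : 0 <= t ->
  \forall w \ae P, dot a (W t w - W 0 w) = dot a (W t w).
Proof. by move=> t0; apply: filterS (brownian0 WB) => w ->; rewrite subr0. Qed.

Lemma linear_brownian0 : \forall w \ae P, L 0 w = 0.
Proof. by apply: filterS (brownian0 WB) => w ->; rewrite dotC dot0l. Qed.

Let mL t : 0 <= t -> measurable_fun setT (L t).
Proof. by move=> t0; exact: measurableT_comp measurable_dota (measurable_brownian WB t0). Qed.

Lemma integrable_linear_brownian t : 0 <= t -> P.-integrable setT (fun w => (L t w)%:E).
Proof.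
rewrite le_eqVlt => /predU1P[<-|t0].
  apply: integrable_ae_eq (finite_measure_integrable_cst P 0 measurableT).
    by apply/measurable_EFinP; exact: mL.
  by apply: filterS linear_brownian0 => w ->.
apply: integrable_ae_eq (integrable_dot_increment a WB (lexx 0) t0).
  by apply/measurable_EFinP; apply: mL; exact: ltW.
by apply: filterS (ae_increment0 (ltW t0)) => w ->.
Qed.

Let mL2 t : 0 <= t -> measurable_fun setT (fun w => (L t w ^+ 2)%:E).
Proof. by move=> t0; apply/measurable_EFinP; apply: measurable_funX; exact: mL. Qed.

Lemma integrable_linear_brownian2 t : 0 <= t ->
  P.-integrable setT (fun w => (L t w ^+ 2)%:E).
Proof.
rewrite le_eqVlt => /predU1P[<-|t0].
  apply: integrable_ae_eq (finite_measure_integrable_cst P 0 measurableT); first exact: mL2.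
  by apply: filterS linear_brownian0 => w ->; rewrite expr0n.
apply: integrable_ae_eq (integrable_dot2_increment a WB (lexx 0) t0).
  by apply: mL2; exact: ltW.
by apply: filterS (ae_increment0 (ltW t0)) => w ->.
Qed.

Lemma integral_linear_brownian2 t : 0 <= t ->
  (\int[P]_w (L t w ^+ 2)%:E = (c * t)%:E)%E.
Proof.
rewrite le_eqVlt => /predU1P[<-|t0].
  rewrite mulr0 (ae_eq_integral (cst 0%E))//; first exact: integral0.
    exact: mL2.
  by apply: filterS linear_brownian0 => w ->; rewrite expr0n.
rewrite -[in RHS](subr0 t) -(integral_dot2_increment a WB (lexx 0) t0).
have /integrableP[m2 _] := integrable_dot2_increment a WB (lexx 0) t0.
apply: ae_eq_integral => //; first by apply: mL2; exact: ltW.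
by apply: filterS (ae_increment0 (ltW t0)) => w ->.
Qed.

Lemma martingale_linear_brownian : martingale P F L.
Proof.
apply: martingale_of_increments => //.
- by move=> t t0; exact: adapted.
- exact: integrable_linear_brownian.
move=> s t A s0 st FA.
have := integral_increment_mul Pc WB s0 st FA (measurable_cst (1 : R)) measurable_dota
  (finite_measure_integrable_cst P 1 measurableT) (integrable_dot_increment a WB s0 st).
rewrite integral_dot_increment// mule0 => <-.
by apply: eq_integral => w _; rewrite mul1r dotDr dotNr.
Qed.

(** (M + D)^2 - M^2 = 2 M D + D^2 for an increment D independent of the past. *)
Lemma martingale_linear_brownian2 : martingale P F (fun t w => L t w ^+ 2 - c * t).
Proof.
have iN t : 0 <= t -> P.-integrable setT (fun w => (L t w ^+ 2 - c * t)%:E).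
  move=> t0; under eq_fun do rewrite EFinB.
  apply: integrableB => //; first exact: integrable_linear_brownian2.
  exact: finite_measure_integrable_cst.
apply: martingale_of_increments => //.
  move=> t t0; apply: (adapted (u := fun x => dot a x ^+ 2 - c * t)) => //.
  by apply: measurable_funB => //; exact: measurable_funX.
move=> s t A s0 st FA.
have i1 := finite_measure_integrable_cst P 1 measurableT.
have iD := integrable_dot_increment a WB s0 st.
have iD2 := integrable_dot2_increment a WB s0 st.
have mdot2 : measurable_fun setT (fun x => dot a x ^+ 2) by exact: measurable_funX.
have iLs := integrable_linear_brownian s0.
have E1 := integral_increment_mul Pc WB s0 st FA measurable_dota measurable_dota iLs iD.
have I1 := integrable_increment_mul Pc WB s0 st FA measurable_dota measurable_dota iLs iD.
have E2 := integral_increment_mul Pc WB s0 st FA (measurable_cst (1 : R)) mdot2 i1 iD2.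
have I2 := integrable_increment_mul Pc WB s0 st FA (measurable_cst (1 : R)) mdot2 i1 iD2.
have mA := Fm FA.
have IA : P.-integrable setT (fun w => (\1_A w : R)%:E) by exact: integrable_indic.
transitivity (\int[P]_w (2%:E * (\1_A w * (dot a (W s w) * dot a (W t w - W s w)))%:E +
   (\1_A w * (1 * dot a (W t w - W s w) ^+ 2))%:E - (c * (t - s))%:E * (\1_A w)%:E))%E.
  apply: eq_integral => w _; rewrite -[RHS]/((2 * (\1_A w * (dot a (W s w) *
    dot a (W t w - W s w))) + \1_A w * (1 * dot a (W t w - W s w) ^+ 2) -
    c * (t - s) * \1_A w)%:E); congr (_%:E).
  by rewrite dotDr dotNr; ring.
rewrite integralB//; last 2 first.
- by apply: integrableD => //; exact: integrableZl.
- exact: integrableZl.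
rewrite integralD//; last exact: integrableZl.
rewrite !integralZl// E1 E2 integral_dot_increment// integral_dot2_increment//.
have -> : (\int[P]_w (\1_A w * cst (1 : R) (W s w))%:E = \int[P]_w (\1_A w)%:E)%E.
  by apply: eq_integral => w _; rewrite mulr1.
rewrite !mule0 add0e [X in (X - _)%E]muleC subee// fin_numM//.
exact: integrable_fin_num IA.
Qed.

End linear_brownian_martingale.

Section linear_martingale.
Context (R : realType) d (Omega : measurableType d) (P : probability Omega R)
  (n m : nat) (W : R -> Omega -> 'cV[R]_n) (f : 'cV[R]_n -> 'cV[R]_m).
Hypothesis Pc : measure_is_complete P.
Hypothesis WB : standard_brownian_motion P W.
Local Notation F := (completed_history P W).

Lemma martingale_modification (M M' : R -> Omega -> R) :
  modification P M M' -> martingale P F M' -> martingale P F M.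
Proof.
move=> MM' [aM iM cM].
have aM' t : 0 <= t -> measurable_wrt (F t) (M t).
  move=> t0 B mB; apply: (completed_ae (aM t t0 B mB)).
  by apply: filterS (MM' t t0) => w /= ->.
have mM t : 0 <= t -> measurable_fun setT (fun w => (M t w)%:E).
  move=> t0; apply/measurable_EFinP => _ B mB; rewrite setTI.
  exact: (completed_measurable Pc WB (aM' t t0 B mB)).
have iM' t : 0 <= t -> P.-integrable setT (fun w => (M t w)%:E).
  move=> t0; apply: integrable_ae_eq (iM t t0); first exact: mM.
  by apply: filterS (MM' t t0) => w /= ->.
split => // s t s0 st; split; [exact: aM'|exact: iM'|].
move=> A FA; have [_ _ E] := cM s t s0 st; have mA := completed_measurable Pc WB FA.
have EM r : 0 <= r ->
    (\int[P]_(w in A) (M r w)%:E = \int[P]_(w in A) (M' r w)%:E)%E.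
  move=> r0; apply: ae_eq_integral => //.
  - exact/measurable_funTS/mM.
  - by have /integrableP[+ _] := iM r r0; exact: measurable_funTS.
  - by apply: filterS (MM' r r0) => w ->.
by rewrite !EM ?(le_trans s0 st)//; exact: E.
Qed.

Section coordinate.
Variable a : 'cV[R]_n.
Local Notation L := (fun t w => dot a (W t w)).
Local Notation c := (gauss_var a).

Let c0 : 0 <= c.
Proof.
apply: fine_ge0; apply: integral_ge0 => x _.
by rewrite lee_fin mulr_ge0 ?sqr_ge0 ?gauss_pdf_ge0.
Qed.

Let Fmono s t : s <= t -> F s `<=` F t. Proof. exact: completed_mono. Qed.

Lemma continuous_linear_brownian : continuous_paths P L.
Proof.
case: WB => _ _ + _ _; apply: filterS => w Wc t.
have dot_continuous : continuous (dot a).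
  apply: continuous_big => [|i _ x]; first exact: (@add_continuous R^o).
  apply: (@continuous_comp _ _ _ (fun y : 'cV[R]_n => y i ord0) ( *%R (a i ord0))).
    exact: coord_continuous.
  exact: mulrl_continuous.
exact: (cvg_comp _ (dot a) (Wc t) (dot_continuous _)).
Qed.

Lemma locally_square_integrable_linear_brownian :
  locally_square_integrable_martingale P F L.
Proof.
exists (fun k _ => k%:R%:E); first exact: localizing_const (sigma_algebra_completed P W).
move=> k; split.
  apply: martingale_stopped_const => //; exact: martingale_linear_brownian.
exists (c * k%:R) => t t0; rewrite stopped_constE.
rewrite integral_linear_brownian2//; last by rewrite le_min t0/=.
by rewrite lee_fin ler_wpM2l// ge_min lexx orbT.
Qed.

Lemma quadratic_variation_linear_brownian :
  predictable_quadratic_variation P F L (fun t _ => c * t).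
Proof.
split.
- apply: predictable_deterministic => //.
  exact: sigma_algebra_completed.
- apply: aeW => w; split => [|s t s0 st|t t0].
  + by rewrite mulr0.
  + by rewrite ler_wpM2l.
  + by apply: cvg_at_right_filter; exact: mulrl_continuous.
- exists (fun k _ => k%:R%:E); first exact: localizing_const (sigma_algebra_completed P W).
  move=> k; apply: martingale_stopped_const => //.
  exact: martingale_linear_brownian2.
Qed.

End coordinate.

Hypothesis f0 : f 0 = 0.

Lemma linear_martingale : linear_ae f -> martingale_transform P W f.
Proof.
move=> [A fA]; pose a j : 'cV[R]_n := (row j A)^T.
have AE x j : (A *m x) j ord0 = dot (a j) x.
  by rewrite mxE; apply: eq_bigr => i _; rewrite !mxE.
have fL j : modification P (fun t w => f (W t w) j ord0) (fun t w => dot (a j) (W t w)).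
  move=> t; rewrite le_eqVlt => /predU1P[<-|t0].
    by apply: filterS (brownian0 WB) => w ->; rewrite f0 mxE dotC dot0l.
  by apply: filterS (ae_brownian WB t0 fA) => w ->; rewrite AE.
split.
- by apply: (lebesgue_measurable_fun_mod _ fA); exact: measurable_mulmx.
- move=> j; apply: martingale_modification (fL j) _.
  exact: martingale_linear_brownian.
- move=> j; exists (gauss_var (a j)), (fun t _ => gauss_var (a j) * t); split.
    exists (fun t w => dot (a j) (W t w)); split.
    + exact: fL.
    + exact: continuous_linear_brownian.
    + exact: locally_square_integrable_linear_brownian.
    + exact: quadratic_variation_linear_brownian.
  by apply: aeW => w s t s0 st; rewrite !subrr.
Qed.

End linear_martingale.

Theorem theorem3 (R : realType) (d : measure_display) (Omega : measurableType d)
    (P : probability Omega R) (n m : nat)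
    (W : R -> Omega -> 'cV[R]_n) (f : 'cV[R]_n -> 'cV[R]_m) :
  measure_is_complete P ->
  standard_brownian_motion P W ->
  (cauchy_equation_ae f <-> linear_ae f) /\
  (f 0 = 0 ->
     (cauchy_equation_ae f <-> martingale_transform P W f) /\
     (martingale_transform P W f <-> linear_ae f)).
Proof.
move=> Pc WB; have CL := @cauchy_linear R n m f; have LC := @linear_cauchy R n m f.
split; first by split.
move=> f0; have MC := martingale_cauchy Pc WB f0; have LM := linear_martingale Pc WB f0.
by split; split; auto.
Qed.
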